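(* Let $H$ be a finite dimensional coquasi Hopf algebra over a field $\Bbbk$, with antipode $S$, let $\overline S$ be the composition inverse of $S$, and let $a\in H$ be the modular element of $H$. Then there exists a convolution-invertible functional $\sigma:H\to\Bbbk$ such that for all $x\in H$ $$a^{-1}\bigl(\overline S^2(x)\,a\bigr)=S^2\bigl(\sigma\rightharpoonup x\leftharpoonup\sigma^{-1}\bigr).$$
   Context: $\Bbbk$ is a field, $\otimes=\otimes_\Bbbk$; for a coalgebra write $\Delta(c)=\sum c_1\otimes c_2$, counit $\varepsilon$; convolution of functionals is $(f\star g)(c)=\sum f(c_1)g(c_2)$. A coquasi bialgebra is a coalgebra $C$ with coalgebra morphisms $p:C\otimes C\to C$, $p(c\otimes d)=cd$, and $u:\Bbbk\to C$, $1=u(1)$, and a convolution-invertible functional $\phi:C\otimes C\otimes C\to\Bbbk$ such that: $1c=c=c1$; $\sum (c_1d_1)e_1\,\phi(c_2\otimes d_2\otimes e_2)=\sum\phi(c_1\otimes d_1\otimes e_1)\,c_2(d_2e_2)$; $\sum\phi(c_1d_1\otimes e_1\otimes f_1)\phi(c_2\otimes d_2\otimes e_2f_2)=\sum\phi(c_1\otimes d_1\otimes e_1)\phi(c_2\otimes d_2e_2\otimes f_1)\phi(d_3\otimes e_3\otimes f_2)$; $\phi(c\otimes1\otimes d)=\varepsilon(c)\varepsilon(d)$. A coquasi Hopf algebra is a coquasi bialgebra $H$ with an antipode $(S,\alpha,\beta)$: a coalgebra morphism $S:H^{\mathrm{cop}}\to H$ and functionals $\alpha,\beta:H\to\Bbbk$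 with $\sum S(h_1)\alpha(h_2)h_3=\alpha(h)1$, $\sum h_1\beta(h_2)S(h_3)=\beta(h)1$, $\sum\phi^{-1}(h_1\otimes Sh_3\otimes h_5)\beta(h_2)\alpha(h_4)=\varepsilon(h)$, $\sum\phi(Sh_1\otimes h_3\otimes Sh_5)\alpha(h_2)\beta(h_4)=\varepsilon(h)$. If $H$ is finite dimensional, $S$ is known to be bijective. For $\gamma:H\to\Bbbk$ and $x\in H$: $\gamma\rightharpoonup x=\sum x_1\gamma(x_2)$ and $x\leftharpoonup\gamma=\sum\gamma(x_1)x_2$. A left cointegral is a linear functional $\varphi:H\to\Bbbk$ with $\sum x_1\varphi(x_2)=\varphi(x)1$ for all $x\in H$. For finite dimensional $H$ the space $W$ of left cointegrals is one dimensional, and the modular element is the group-like element $a\in H$ with $\sum\varphi(x_1)x_2=\varphi(x)a$ for all $\varphi\in W$, $x\in H$. For a group-like element $a$, $a^{-1}=S(a)$ is the unique element with $aa^{-1}=a^{-1}a=1$. *)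

(* Defs.v *)
From HB Require Import structures.
From mathcomp Require Import all_boot all_order all_algebra.

Set Implicit Arguments.
Unset Strict Implicit.
Unset Printing Implicit Defensive.

Import GRing.Theory.
Local Open Scope ring_scope.

(* Tensor product of finite dimensional spaces, modelled by coefficient
   matrices on the library's chosen bases.  Only the pure tensors [tens] and
   the factorization [tlift] of bilinear maps are used below; lemmas
   [tlift_tens] and [tensor_ext] are the universal property. *)
Section Tensor.
Variable K : fieldType.

Definition tensor (V W : vectType K) : vectType K :=
  'M[K]_(\dim {:V}, \dim {:W}).

Definition tens (V W : vectType K) (v : V) (w : W) : tensor V W :=
  \matrix_(i, j) (coord (vbasis {:V}) i v * coord (vbasis {:W}) j w).

(* [tlift F] is the linear map induced by F; it is meaningful
   (independent of the bases) when F is bilinear. *)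
Definition tlift (V W : vectType K) (U : lmodType K) (F : V -> W -> U)
    (t : tensor V W) : U :=
  \sum_i \sum_j (t : 'M[K]_(\dim {:V}, \dim {:W})) i j
                  *: F (vbasis {:V})`_i (vbasis {:W})`_j.

Fact tlift_is_linear (V W : vectType K) (U : lmodType K) (F : V -> W -> U) :
  linear (@tlift V W U F).
Proof.
move=> a s t; rewrite /tlift scaler_sumr -big_split; apply: eq_bigr => i _ /=.
rewrite scaler_sumr -big_split; apply: eq_bigr => j _ /=.
by rewrite !mxE scalerDl scalerA.
Qed.

HB.instance Definition _ (V W : vectType K) (U : lmodType K) (F : V -> W -> U) :=
  GRing.isLinear.Build K (tensor V W) U *:%R (@tlift V W U F)
    (@tlift_is_linear V W U F).

End Tensor.

Notation "v \ox w" := (tens v w) (at level 40, left associativity).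

Section TensorTheory.
Variable K : fieldType.
Implicit Types (V W : vectType K) (U : lmodType K).

Lemma eq_tlift V W U (F G : V -> W -> U) t :
  (forall v w, F v w = G v w) -> tlift F t = tlift G t.
Proof.
by move=> eFG; apply: eq_bigr => i _; apply: eq_bigr => j _; rewrite eFG.
Qed.

Lemma linear_tlift V W U U' (f : {linear U -> U'}) (F : V -> W -> U) t :
  f (tlift F t) = tlift (fun v w => f (F v w)) t.
Proof.
rewrite /tlift linear_sum; apply: eq_bigr => i _.
by rewrite linear_sum; apply: eq_bigr => j _; rewrite linearZ.
Qed.


Lemma tlift_pair V W U (F : V -> W -> U) (t : tensor V W) :
  tlift F t = \sum_p (t : 'M[K]_(\dim {:V}, \dim {:W})) p.1 p.2
                  *: F (vbasis {:V})`_p.1 (vbasis {:W})`_p.2.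
Proof. by rewrite /tlift pair_bigA. Qed.

Lemma exchange_tlift V W V' W' U (F : V -> W -> V' -> W' -> U) t t' :
  tlift (fun v w => tlift (F v w) t') t =
  tlift (fun v' w' => tlift (fun v w => F v w v' w') t) t'.
Proof.
rewrite !tlift_pair; under eq_bigr do rewrite tlift_pair scaler_sumr.
under [RHS]eq_bigr do rewrite tlift_pair scaler_sumr.
rewrite exchange_big; apply: eq_bigr => p _; apply: eq_bigr => q _.
by rewrite !scalerA mulrC.
Qed.

Lemma tens_linearl V W (w : W) : linear (fun v : V => v \ox w).
Proof. by move=> a u v; apply/matrixP=> i j; rewrite !mxE linearP mulrDl mulrA. Qed.

Lemma tens_linearr V W (v : V) : linear (fun w : W => v \ox w).
Proof.
by move=> a u w; apply/matrixP=> i j; rewrite !mxE linearP mulrDr mulrCA.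
Qed.

Lemma tensZl V W a (v : V) (w : W) : (a *: v) \ox w = a *: (v \ox w).
Proof. by apply/matrixP=> i j; rewrite !mxE linearZ mulrA. Qed.

Lemma tensZr V W a (v : V) (w : W) : v \ox (a *: w) = a *: (v \ox w).
Proof. by apply/matrixP=> i j; rewrite !mxE linearZ mulrCA. Qed.

Lemma linear_id U : linear (fun u : U => u).
Proof. by []. Qed.

Lemma linear_app U U' U'' (f : {linear U' -> U''}) (g : U -> U') :
  linear g -> linear (fun u => f (g u)).
Proof. by move=> lg a u v; rewrite lg linearP. Qed.

Lemma linear_tensl V W U (f : U -> V) (w : W) :
  linear f -> linear (fun u => f u \ox w).
Proof. by move=> lf a u v; rewrite lf tens_linearl. Qed.

Lemma linear_tensr V W U (f : U -> W) (v : V) :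
  linear f -> linear (fun u => v \ox f u).
Proof. by move=> lf a u w; rewrite lf tens_linearr. Qed.

Lemma linear_tliftF V W U U' (F : U' -> V -> W -> U) t :
  (forall v w, linear (fun u => F u v w)) -> linear (fun u => tlift (F u) t).
Proof.
move=> lF a u v; rewrite !tlift_pair scaler_sumr -big_split /=.
by apply: eq_bigr => p _; rewrite lF scalerDr !scalerA mulrC.
Qed.

Lemma linear_tliftt V W U U' (F : V -> W -> U) (f : U' -> tensor V W) :
  linear f -> linear (fun u => tlift F (f u)).
Proof. by move=> lf a u v; rewrite lf linearP. Qed.

Lemma linear_scalel U U' (f : U -> K^o) (x : U') :
  linear f -> linear (fun u => (f u : K) *: x).
Proof. by move=> lf a u v; rewrite lf scalerDl scalerA. Qed.

Lemma linear_scaler U U' (f : U -> U') (k : K) :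
  linear f -> linear (fun u => k *: f u).
Proof. by move=> lf a u v; rewrite lf scalerDr !scalerA mulrC. Qed.

Lemma linear_mull U (f : U -> K^o) (k : K^o) :
  linear f -> linear (fun u => f u * k : K^o).
Proof. by move=> lf a u v; rewrite lf mulrDl -scalerAl. Qed.

Lemma linear_mulr U (f : U -> K^o) (k : K^o) :
  linear f -> linear (fun u => k * f u : K^o).
Proof. by move=> lf a u v; rewrite lf mulrDr -scalerAr. Qed.

Lemma tlift_tens V W U (F : V -> W -> U) v w :
  (forall w, linear (F^~ w)) -> (forall v, linear (F v)) ->
  tlift F (v \ox w) = F v w.
Proof.
move=> lFl lFr.
pose Fl w : {linear V -> U} :=
  HB.pack (F^~ w) (GRing.isLinear.Build K V U *:%R (F^~ w) (lFl w)).
pose Fr v : {linear W -> U} :=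
  HB.pack (F v) (GRing.isLinear.Build K W U *:%R (F v) (lFr v)).
rewrite {2}(coord_vbasis (memvf v)) -[RHS]/(Fl w _) linear_sum.
apply: eq_bigr => i _; rewrite linearZ /= [X in F _ X](coord_vbasis (memvf w)).
rewrite -[F _ _]/(Fr _ _) linear_sum scaler_sumr; apply: eq_bigr => j _.
by rewrite linearZ /= scalerA mxE.
Qed.

Lemma tensor_span V W (t : tensor V W) : t = tlift (fun v w => v \ox w) t.
Proof.
apply/matrixP=> i j; rewrite summxE (bigD1 i) //= summxE (bigD1 j) //= !mxE.
rewrite !coord_free ?(basis_free (vbasisP _)) // !eqxx !mulr1.
rewrite big1 => [|j' ne]; last first.
  rewrite !mxE [coord _ j _]coord_free ?(basis_free (vbasisP _)) //.
  by rewrite (negPf ne) !mulr0.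
rewrite big1 ?addr0 // => i' ne; rewrite summxE big1 // => j' _.
rewrite !mxE [coord _ i _]coord_free ?(basis_free (vbasisP _)) //.
by rewrite (negPf ne) mul0r mulr0.
Qed.

Lemma tensor_ext V W U (f g : {linear tensor V W -> U}) :
  (forall v w, f (v \ox w) = g (v \ox w)) -> f =1 g.
Proof.
move=> efg t; rewrite (tensor_span t) !linear_tlift.
exact: eq_tlift.
Qed.

End TensorTheory.

Ltac linear_tac := repeat first
  [ exact: linear_id | apply: linear_tensl | apply: linear_tensr
  | apply: linear_scalel | apply: linear_scaler
  | apply: linear_mull | apply: linear_mulr
  | apply: linear_tliftt | (apply: linear_tliftF => ? ?) | apply: linear_app ].

Record coalgebra (K : fieldType) := Coalgebra {
  coalg_sort :> vectType K;
  comul : {linear coalg_sort -> tensor coalg_sort coalg_sort};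
  counit : {linear coalg_sort -> K^o};
  coassoc : forall c,
    tlift (fun x c3 => tlift (fun c1 c2 => c1 \ox (c2 \ox c3)) (comul x))
      (comul c) =
    tlift (fun c1 x => tlift (fun c2 c3 => c1 \ox (c2 \ox c3)) (comul x))
      (comul c);
  counitl : forall c, tlift (fun c1 c2 => counit c1 *: c2) (comul c) = c;
  counitr : forall c, tlift (fun c1 c2 => counit c2 *: c1) (comul c) = c
}.

(* In [sw2 c F] and its iterates, [F c1 c2] is the summand of a Sweedler sum;
   [F] is multilinear in every use below.  Iterated coproducts are bracketed
   to the left, which is immaterial by coassociativity. *)
Section Sweedler.
Variables (K : fieldType) (C : coalgebra K) (U : lmodType K).

Definition sw2 (c : C) (F : C -> C -> U) : U := tlift F (comul C c).

Definition sw3 (c : C) (F : C -> C -> C -> U) : U :=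
  sw2 c (fun x c3 => sw2 x (fun c1 c2 => F c1 c2 c3)).

Definition sw4 (c : C) (F : C -> C -> C -> C -> U) : U :=
  sw2 c (fun x c4 => sw3 x (fun c1 c2 c3 => F c1 c2 c3 c4)).

Definition sw5 (c : C) (F : C -> C -> C -> C -> C -> U) : U :=
  sw2 c (fun x c5 => sw4 x (fun c1 c2 c3 c4 => F c1 c2 c3 c4 c5)).

End Sweedler.

Section CoalgebraConstructions.
Variable K : fieldType.

Lemma coassoc_multi (C : coalgebra K) (U : lmodType K)
    (G : C -> C -> C -> U) (c : C) :
  (forall x y, linear (fun z => G z x y)) ->
  (forall x y, linear (fun z => G x z y)) ->
  (forall x y, linear (fun z => G x y z)) ->
  tlift (fun x c3 => tlift (fun c1 c2 => G c1 c2 c3) (comul C x)) (comul C c) =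
  tlift (fun c1 x => tlift (fun c2 c3 => G c1 c2 c3) (comul C x)) (comul C c).
Proof.
move=> l1 l2 l3; pose G' : tensor C (tensor C C) -> U :=
  tlift (fun a t => tlift (fun b d => G a b d) t).
have GE a b d : G' (a \ox (b \ox d)) = G a b d.
  rewrite /G' !tlift_tens //; first by move=> t; linear_tac.
  by move=> t; linear_tac.
have GE2 t x : G' (tlift (fun c1 c2 => c1 \ox (c2 \ox x)) t) =
    tlift (fun c1 c2 => G c1 c2 x) t.
  by rewrite [LHS]linear_tlift; apply: eq_tlift => *; apply: GE.
have GE2' t x : G' (tlift (fun c2 c3 => x \ox (c2 \ox c3)) t) =
    tlift (fun c2 c3 => G x c2 c3) t.
  by rewrite [LHS]linear_tlift; apply: eq_tlift => *; apply: GE.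
transitivity (G' (tlift (fun x c3 =>
    tlift (fun c1 c2 => c1 \ox (c2 \ox c3)) (comul C x)) (comul C c))).
  by rewrite [RHS]linear_tlift; apply: eq_tlift => ? ?; symmetry; apply: GE2.
rewrite coassoc [LHS]linear_tlift; apply: eq_tlift => ? ?; exact: GE2'.
Qed.

Section Tensor.
Variables C D : coalgebra K.

Definition tensor_comul : tensor C D -> tensor (tensor C D) (tensor C D) :=
  tlift (fun c d => sw2 c (fun c1 c2 => sw2 d (fun d1 d2 =>
    (c1 \ox d1) \ox (c2 \ox d2)))).

Definition tensor_counit : tensor C D -> K^o :=
  tlift (fun c d => counit C c * counit D d : K^o).

HB.instance Definition _ := GRing.Linear.on tensor_comul.
HB.instance Definition _ := GRing.Linear.on tensor_counit.

Lemma tensor_comulE c d : tensor_comul (c \ox d) =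
  sw2 c (fun c1 c2 => sw2 d (fun d1 d2 => (c1 \ox d1) \ox (c2 \ox d2))).
Proof. by rewrite /tensor_comul /sw2 tlift_tens // => ?; linear_tac. Qed.

Lemma tensor_counitE c d :
  tensor_counit (c \ox d) = counit C c * counit D d.
Proof. by rewrite /tensor_counit tlift_tens // => ?; linear_tac. Qed.

Lemma tlift_tensor_comul (U : lmodType K)
    (F : tensor C D -> tensor C D -> U) c d :
  (forall y, linear (F^~ y)) -> (forall x, linear (F x)) ->
  tlift F (tensor_comul (c \ox d)) =
  sw2 c (fun c1 c2 => sw2 d (fun d1 d2 => F (c1 \ox d1) (c2 \ox d2))).
Proof.
move=> lFl lFr; rewrite tensor_comulE [LHS]linear_tlift.
apply: eq_tlift => c1 c2; rewrite [LHS]linear_tlift.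
by apply: eq_tlift => d1 d2; apply: tlift_tens.
Qed.

Lemma tensor_coassoc (t : tensor C D) :
  tlift (fun x t3 => tlift (fun t1 t2 => t1 \ox (t2 \ox t3)) (tensor_comul x))
    (tensor_comul t) =
  tlift (fun t1 x => tlift (fun t2 t3 => t1 \ox (t2 \ox t3)) (tensor_comul x))
    (tensor_comul t).
Proof.
pose T := tensor C D.
pose F1 (x t3 : T) := tlift (fun t1 t2 : T => t1 \ox (t2 \ox t3)) (tensor_comul x).
pose F2 (t1 x : T) := tlift (fun t2 t3 : T => t1 \ox (t2 \ox t3)) (tensor_comul x).
apply: (@tensor_ext _ _ _ _ (tlift F1 \o tensor_comul) (tlift F2 \o tensor_comul)).
move=> c d /=; rewrite !tlift_tensor_comul; try by move=> ?; rewrite /F1 /F2; linear_tac.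
pose G c1 c2 c3 d1 d2 d3 : tensor T (tensor T T) :=
  (c1 \ox d1) \ox ((c2 \ox d2) \ox (c3 \ox d3)).
transitivity (sw2 c (fun x c3 => sw2 x (fun c1 c2 =>
    sw2 d (fun y d3 => sw2 y (fun d1 d2 => G c1 c2 c3 d1 d2 d3))))).
  apply: eq_tlift => x c3; rewrite /sw2 exchange_tlift.
  apply: eq_tlift => y d3; rewrite /F1 tlift_tensor_comul //; move=> ?; by linear_tac.
rewrite [LHS]coassoc_multi; try by move=> ? ?; rewrite /G; linear_tac.
apply: eq_tlift => c1 x; rewrite [RHS]/sw2.
transitivity (sw2 x (fun c2 c3 => sw2 d (fun d1 y => sw2 y (fun d2 d3 =>
    G c1 c2 c3 d1 d2 d3)))).
  apply: eq_tlift => c2 c3.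
  by apply: coassoc_multi => ? ?; rewrite /G; linear_tac.
rewrite [LHS]exchange_tlift; apply: eq_tlift => d1 y.
by rewrite /F2 tlift_tensor_comul // => ?; linear_tac.
Qed.

Lemma tensor_counitl (t : tensor C D) :
  tlift (fun t1 t2 => tensor_counit t1 *: t2) (tensor_comul t) = t.
Proof.
pose F (t1 t2 : tensor C D) : tensor C D := (tensor_counit t1 : K) *: t2.
apply: (@tensor_ext _ _ _ _ (tlift F \o tensor_comul) idfun) => c d /=.
rewrite tlift_tensor_comul; try by move=> ?; rewrite /F; linear_tac.
rewrite -[in RHS](counitl c) -[in RHS](counitl d).
pose TD e : {linear C -> tensor C D} := HB.pack (fun c : C => c \ox e)
  (GRing.isLinear.Build K C (tensor C D) *:%R _ (tens_linearl e)).
pose TC c : {linear D -> tensor C D} := HB.pack (fun d : D => c \ox d)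
  (GRing.isLinear.Build K D (tensor C D) *:%R _ (tens_linearr c)).
rewrite -[RHS]/(TD _ _) linear_tlift; apply: eq_tlift => c1 c2.
rewrite -[RHS]/(TC _ _) linear_tlift; apply: eq_tlift => d1 d2.
by rewrite /F /= tensor_counitE tensZl tensZr scalerA.
Qed.

Lemma tensor_counitr (t : tensor C D) :
  tlift (fun t1 t2 => tensor_counit t2 *: t1) (tensor_comul t) = t.
Proof.
pose F (t1 t2 : tensor C D) : tensor C D := (tensor_counit t2 : K) *: t1.
apply: (@tensor_ext _ _ _ _ (tlift F \o tensor_comul) idfun) => c d /=.
rewrite tlift_tensor_comul; try by move=> ?; rewrite /F; linear_tac.
rewrite -[in RHS](counitr c) -[in RHS](counitr d).
pose TD e : {linear C -> tensor C D} := HB.pack (fun c : C => c \ox e)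
  (GRing.isLinear.Build K C (tensor C D) *:%R _ (tens_linearl e)).
pose TC c : {linear D -> tensor C D} := HB.pack (fun d : D => c \ox d)
  (GRing.isLinear.Build K D (tensor C D) *:%R _ (tens_linearr c)).
rewrite -[RHS]/(TD _ _) linear_tlift; apply: eq_tlift => c1 c2.
rewrite -[RHS]/(TC _ _) linear_tlift; apply: eq_tlift => d1 d2.
by rewrite /F /= tensor_counitE tensZl tensZr scalerA.
Qed.

Definition tensor_coalg : coalgebra K :=
  Coalgebra tensor_coassoc tensor_counitl tensor_counitr.

End Tensor.

Section Cop.
Variable C : coalgebra K.

Definition cop_comul : C -> tensor C C :=
  fun c => sw2 c (fun c1 c2 => c2 \ox c1).

Fact cop_comul_is_linear : linear cop_comul.
Proof. by move=> a u v; rewrite /cop_comul /sw2 !linearP. Qed.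

HB.instance Definition _ :=
  GRing.isLinear.Build K C (tensor C C) *:%R cop_comul cop_comul_is_linear.

Lemma tlift_cop (U : lmodType K) (F : C -> C -> U) c :
  (forall y, linear (F^~ y)) -> (forall x, linear (F x)) ->
  tlift F (cop_comul c) = tlift (fun c1 c2 => F c2 c1) (comul C c).
Proof.
by move=> ? ?; rewrite [LHS]linear_tlift; apply: eq_tlift => ? ?; apply: tlift_tens.
Qed.

Lemma cop_coassoc (c : C) :
  tlift (fun x c3 => tlift (fun c1 c2 => c1 \ox (c2 \ox c3)) (cop_comul x))
    (cop_comul c) =
  tlift (fun c1 x => tlift (fun c2 c3 => c1 \ox (c2 \ox c3)) (cop_comul x))
    (cop_comul c).
Proof.
rewrite !tlift_cop; try by move=> ?; linear_tac.
transitivity (sw2 c (fun c1 x => sw2 x (fun c2 c3 => c3 \ox (c2 \ox c1)))).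
  by apply: eq_tlift => ? ?; rewrite tlift_cop // => ?; linear_tac.
rewrite -[LHS]coassoc_multi; try by move=> ? ?; linear_tac.
by apply: eq_tlift => ? ?; rewrite tlift_cop // => ?; linear_tac.
Qed.

Lemma cop_counitl (c : C) :
  tlift (fun c1 c2 => counit C c1 *: c2) (cop_comul c) = c.
Proof.
by rewrite tlift_cop ?[LHS]counitr // => ?; linear_tac.
Qed.

Lemma cop_counitr (c : C) :
  tlift (fun c1 c2 => counit C c2 *: c1) (cop_comul c) = c.
Proof.
by rewrite tlift_cop ?[LHS]counitl // => ?; linear_tac.
Qed.

Definition cop_coalg : coalgebra K :=
  Coalgebra cop_coassoc cop_counitl cop_counitr.

End Cop.

Section Base.

Definition base_comul : K^o -> tensor K^o K^o :=
  fun x => (x : K) *: ((1 : K^o) \ox (1 : K^o)).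

Fact base_comul_is_linear : linear base_comul.
Proof. by move=> a u v; rewrite /base_comul scalerDl scalerA. Qed.

HB.instance Definition _ :=
  GRing.isLinear.Build K K^o (tensor K^o K^o) *:%R base_comul
    base_comul_is_linear.

Lemma tlift_base (U : lmodType K) (F : K^o -> K^o -> U) (c : K^o) :
  (forall y, linear (F^~ y)) -> (forall x, linear (F x)) ->
  tlift F (base_comul c) = (c : K) *: F 1 1.
Proof. by move=> ? ?; rewrite [LHS]linearZ /= tlift_tens. Qed.

Lemma base_coassoc (c : K^o) :
  tlift (fun x c3 => tlift (fun c1 c2 => c1 \ox (c2 \ox c3)) (base_comul x))
    (base_comul c) =
  tlift (fun c1 x => tlift (fun c2 c3 => c1 \ox (c2 \ox c3)) (base_comul x))
    (base_comul c).
Proof.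
rewrite !tlift_base; try by move=> ?; linear_tac.
by rewrite !scale1r.
Qed.

Lemma base_counitl (c : K^o) :
  tlift (fun c1 c2 : K^o => (idfun c1 : K) *: c2) (base_comul c) = c.
Proof.
by rewrite tlift_base ?scale1r ?[LHS]mulr1 // => ?; linear_tac.
Qed.

Lemma base_counitr (c : K^o) :
  tlift (fun c1 c2 : K^o => (idfun c2 : K) *: c1) (base_comul c) = c.
Proof.
by rewrite tlift_base ?scale1r ?[LHS]mulr1 // => ?; linear_tac.
Qed.

Definition base_coalg : coalgebra K :=
  @Coalgebra K K^o base_comul idfun base_coassoc base_counitl base_counitr.

End Base.
End CoalgebraConstructions.

Definition coalg_morphism (K : fieldType) (C D : coalgebra K)
    (f : {linear C -> D}) : Prop :=
  (forall c, comul D (f c) = sw2 c (fun c1 c2 => f c1 \ox f c2)) /\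
  (forall c, counit D (f c) = counit C c).

Section Convolution.
Variables (K : fieldType) (C : coalgebra K).

Definition conv (f g : {linear C -> K^o}) (c : C) : K^o :=
  sw2 c (fun c1 c2 => f c1 * g c2 : K^o).

Definition conv_inverse (f g : {linear C -> K^o}) : Prop :=
  (forall c, conv f g c = counit C c) /\ (forall c, conv g f c = counit C c).

Definition hit_left (f : {linear C -> K^o}) (x : C) : C :=
  sw2 x (fun x1 x2 => (f x2 : K) *: x1).

Definition hit_right (x : C) (f : {linear C -> K^o}) : C :=
  sw2 x (fun x1 x2 => (f x1 : K) *: x2).

Definition grouplike (g : C) : Prop :=
  comul C g = g \ox g /\ counit C g = 1.

End Convolution.

Notation "f '-\>' x" := (hit_left f x) (at level 41, right associativity).
Notation "x '<\-' f" := (hit_right x f) (at level 42, left associativity).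

Definition tensor3_coalg (K : fieldType) (C : coalgebra K) : coalgebra K :=
  tensor_coalg (tensor_coalg C C) C.

(* The convolution inverse of the reassociator is unique, so recording it as a
   field only names it. *)
Record coquasi_bialgebra (K : fieldType) := CoquasiBialgebra {
  cqb_coalg :> coalgebra K;
  cqb_mul : {linear tensor_coalg cqb_coalg cqb_coalg -> cqb_coalg};
  cqb_unit : {linear base_coalg K -> cqb_coalg};
  reassoc : {linear tensor3_coalg cqb_coalg -> K^o};
  reassocV : {linear tensor3_coalg cqb_coalg -> K^o};
  cqb_axioms : let C := cqb_coalg in
      let m (c d : C) : C := cqb_mul (c \ox d) in
      let one : C := cqb_unit 1 in
      let phi (c d e : C) : K := reassoc (c \ox d \ox e) in
    [/\ coalg_morphism cqb_mul /\ coalg_morphism cqb_unit,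
        conv_inverse reassoc reassocV,
        forall c, m one c = c /\ m c one = c,
        forall c d e,
          sw2 c (fun c1 c2 => sw2 d (fun d1 d2 => sw2 e (fun e1 e2 =>
            phi c2 d2 e2 *: m (m c1 d1) e1))) =
          sw2 c (fun c1 c2 => sw2 d (fun d1 d2 => sw2 e (fun e1 e2 =>
            phi c1 d1 e1 *: m c2 (m d2 e2)))) &
        (forall c d e f,
          sw2 c (fun c1 c2 => sw2 d (fun d1 d2 =>
          sw2 e (fun e1 e2 => sw2 f (fun f1 f2 =>
            phi (m c1 d1) e1 f1 * phi c2 d2 (m e2 f2) : K^o)))) =
          sw2 c (fun c1 c2 => sw3 d (fun d1 d2 d3 =>
          sw3 e (fun e1 e2 e3 => sw2 f (fun f1 f2 =>
            phi c1 d1 e1 * phi c2 (m d2 e2) f1 * phi d3 e3 f2 : K^o))))) /\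
        (forall c d, phi c one d = counit C c * counit C d)]
}.

Definition cqmul (K : fieldType) (C : coquasi_bialgebra K) (c d : C) : C :=
  cqb_mul C (c \ox d).

Definition cqone (K : fieldType) (C : coquasi_bialgebra K) : C :=
  cqb_unit C 1.

Arguments cqone {K C}.

Notation "c \cm d" := (cqmul c d) (at level 40, left associativity).

Record coquasi_hopf (K : fieldType) := CoquasiHopf {
  cqh_bialg :> coquasi_bialgebra K;
  antipode : {linear cop_coalg cqh_bialg -> cqh_bialg};
  antipode_alpha : {linear cqh_bialg -> K^o};
  antipode_beta : {linear cqh_bialg -> K^o};
  cqh_axioms : let H := cqh_bialg in
      let S (h : H) : H := antipode h in
      let alpha (h : H) : K := antipode_alpha h in
      let beta (h : H) : K := antipode_beta h in
      let phi (c d e : H) : K := reassoc H (c \ox d \ox e) in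
      let phiV (c d e : H) : K := reassocV H (c \ox d \ox e) in
    [/\ coalg_morphism antipode,
        forall h, sw3 h (fun h1 h2 h3 => alpha h2 *: (S h1 \cm h3)) =
                  alpha h *: cqone,
        forall h, sw3 h (fun h1 h2 h3 => beta h2 *: (h1 \cm S h3)) =
                  beta h *: cqone,
        forall h, sw5 h (fun h1 h2 h3 h4 h5 =>
                    phiV h1 (S h3) h5 * beta h2 * alpha h4 : K^o) =
                  counit H h &
        forall h, sw5 h (fun h1 h2 h3 h4 h5 =>
                    phi (S h1) h3 (S h5) * alpha h2 * beta h4 : K^o) =
                  counit H h]
}.

Section Cointegrals.
Variables (K : fieldType) (H : coquasi_hopf K).

Definition left_cointegral (f : {linear H -> K^o}) : Prop :=
  forall x : H, sw2 x (fun x1 x2 => (f x2 : K) *: x1) = (f x : K) *: cqone.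

(* Not asking for a nonzero cointegral costs nothing: the space of left
   cointegrals of such an [H] is always one dimensional. *)
Definition modular_element (a : H) : Prop :=
  grouplike a /\
  forall f : {linear H -> K^o}, left_cointegral f ->
    forall x : H, sw2 x (fun x1 x2 => (f x1 : K) *: x2) = (f x : K) *: a.

(* Inverse of group-like elements only. *)
Definition grouplike_inv (a : H) : H := antipode H a.

End Cointegrals.

(* Main.v *)
(* Let f be a left cointegral and B(x, y) = f(xy). Bending the leg y of B with the
   antipode on one side and with its inverse on the other side turns B into a
   nondegenerate form B3 such that
     x1 B3(x2, y) = S^-1(y1) B3(x, y2) and B3(x1, y) x2 = B3(x, y1) (a S(y2)).
   The radical of B3 vanishes because it is a subbicomodule on which f(xy) is zero,
   which forces alpha, and then the counit, to vanish on it. If B3(L, -) is the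
   counit, these two relations give n -\> L = L <\- (n o (a S^2(-))) for every
   functional n, and n |-> L <\- n is bijective. The opposite algebra has the same
   left cointegrals and the same modular element, and yields in the same way L' with
   n -\> L' = L' <\- (n o (S^-2(-) a)). Since L' = L <\- c for an invertible c, the
   maps a S^2(-) and S^-2(-) a are conjugate under c; finally the reassociator
   conjugates a^-1 (a z) into z. A nonzero left cointegral is obtained as a trace of
   the maps y |-> x S^2(y), as for ordinary Hopf algebras. *)

(* The product is associative only up to phi, so f(xy) alone satisfies no clean transposition rule.
   The corrections are absorbed by two forms built from the reassociator, alpha and beta: B3 is the
   convolution product of [qform (cop_data D)], B and [qform D]. Only one bend is ever computed. The
   other is the same bend for the co-opposite coalgebra, where the modular element is replaced by 1,
   and the two do not interfere because invariance on one side survives convolution on the other.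
   The square of the antipode arises by comparing the two bends on L: against y, n -\> L gives n(a
   S(y)) and L <\- n gives n(S^-1(y)). The functional c has no closed formula, since it only records
   how L' is reached from L; the explicit factor of sigma is phi(a^-1, a, S^2(x)), produced by
   cancelling a^-1 against a. To keep reassociators and coproducts manageable, identities are
   checked on matrix coefficients of comodules, where convolution becomes matrix multiplication,
   passing to the opposite algebra reverses the factors, and passing to the co-opposite coalgebra
   transposes the matrices. *)
Require Import Defs.
From HB Require Import structures.
From mathcomp Require Import all_boot all_order all_algebra.
From mathcomp Require Import ring.

Set Implicit Arguments.
Unset Strict Implicit.
Unset Printing Implicit Defensive.

Import GRing.Theory.
Local Open Scope ring_scope.

(** * Nested sums and linear maps *)

Ltac under_sum tac :=
  eapply etrans; [apply: eq_bigr => ? _; tac (); reflexivity | cbv beta].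

(* Moves the [n]-th of the nested sums heading the left-hand side to the front. *)
Ltac pull_sum n :=
  lazymatch n with
  | O => idtac
  | S O => rewrite [LHS]exchange_big /=
  | S ?m => under_sum ltac:(fun _ => pull_sum m); rewrite [LHS]exchange_big /=
  end.

(** Distributes products and scalings over sums at every depth, so that the left-hand side becomes
    one block of nested sums on which [pull_sum] can act. *)
Ltac flat_sums :=
  rewrite ?[in LHS](mulr_sumr, mulr_suml, scaler_sumr, scaler_suml);
  try (under_sum ltac:(fun _ => flat_sums)).

Section Linear.
Variables (K : fieldType) (U V : lmodType K).

(** Linearity is kept as a predicate on bare functions here and below, because most of the maps are
    partial applications such as [mul D x], which carry no bundled structure. *)
Lemma lin_sum (f : U -> V) (I : finType) (F : I -> U) :
  linear f -> f (\sum_i F i) = \sum_i f (F i).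
Proof.
move=> lf.
pose g : {linear U -> V} := HB.pack f (GRing.isLinear.Build K U V *:%R f lf).
by rewrite -[f]/(g : U -> V) linear_sum.
Qed.

Lemma linZ (f : U -> V) a x : linear f -> f (a *: x) = a *: f x.
Proof.
move=> lf.
pose g : {linear U -> V} := HB.pack f (GRing.isLinear.Build K U V *:%R f lf).
by rewrite -[f]/(g : U -> V) linearZ.
Qed.

Lemma lin0 (f : U -> V) : linear f -> f 0 = 0.
Proof. by move=> lf; rewrite -[X in f X](scale0r (0 : U)) linZ // scale0r. Qed.

Lemma lin_comb (f : U -> V) (I : finType) (c : I -> K) (F : I -> U) :
  linear f -> f (\sum_i c i *: F i) = \sum_i c i *: f (F i).
Proof. by move=> lf; rewrite lin_sum //; apply: eq_bigr => i _; rewrite linZ. Qed.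

Lemma scal_comb (f : U -> K) (I : finType) (c : I -> K) (F : I -> U) :
  scalar f -> f (\sum_i c i *: F i) = \sum_i c i * f (F i).
Proof.
move=> lf; pose g : {scalar U} := HB.pack f (GRing.isLinear.Build K U K *%R f lf).
rewrite -[f]/(g : U -> K) linear_sum.
by apply: eq_bigr => i _; rewrite linearZ.
Qed.

Lemma scalZ (f : U -> K) a x : scalar f -> f (a *: x) = a * f x.
Proof.
move=> lf; pose g : {scalar U} := HB.pack f (GRing.isLinear.Build K U K *%R f lf).
by rewrite -[f]/(g : U -> K) linearZ.
Qed.

Lemma sum_deltal (I : finType) (F : I -> V) i : \sum_k (i == k)%:R *: F k = F i.
Proof.
rewrite (bigD1 i) //= eqxx scale1r big1 ?addr0 // => k.
by rewrite eq_sym => /negPf->; rewrite scale0r.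
Qed.

Lemma sum_deltalK (I : finType) (F : I -> K) i : \sum_k (i == k)%:R * F k = F i.
Proof.
rewrite (bigD1 i) //= eqxx mul1r big1 ?addr0 // => k.
by rewrite eq_sym => /negPf->; rewrite mul0r.
Qed.

Lemma sum_deltarK (I : finType) (F : I -> K) i : \sum_k (k == i)%:R * F k = F i.
Proof. by rewrite -[RHS]sum_deltalK; apply: eq_bigr => k _; rewrite eq_sym. Qed.

End Linear.

(** * Comatrices *)

Section Comatrix.
Variables (K : fieldType) (C : coalgebra K).

(* The matrix coefficients of a comodule with basis indexed by [I]. On such
   elements every Sweedler sum becomes a sum over indices, where coassociativity
   is built in; identities between linear maps need only be checked there. *)
Definition comatrix (I : finType) (t : I -> I -> C) : Prop :=
  forall i j, comul C (t i j) = \sum_k t i k \ox t k j /\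
              counit C (t i j) = (i == j)%:R.

Lemma sw2_comatrix (U : lmodType K) (F : C -> C -> U) (I : finType)
    (t : I -> I -> C) i j :
  comatrix t -> (forall y, linear (F^~ y)) -> (forall x, linear (F x)) ->
  sw2 (t i j) F = \sum_k F (t i k) (t k j).
Proof.
move=> tM lF rF; rewrite /sw2 (tM i j).1 linear_sum.
by apply: eq_bigr => k _; apply: tlift_tens.
Qed.

Lemma sw3_comatrix (U : lmodType K) (F : C -> C -> C -> U) (I : finType)
    (t : I -> I -> C) i j :
  comatrix t -> (forall y z, linear (fun x => F x y z)) ->
  (forall x z, linear (fun y => F x y z)) -> (forall x y, linear (F x y)) ->
  sw3 (t i j) F = \sum_k \sum_l F (t i k) (t k l) (t l j).
Proof.
move=> tM l1 l2 l3; rewrite /sw3 sw2_comatrix //.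
- under eq_bigr => l _ do rewrite sw2_comatrix //.
  by rewrite exchange_big.
- by move=> y; rewrite /sw2; linear_tac.
- by move=> x; rewrite /sw2; linear_tac.
Qed.

(* Contraction of the right leg of the coproduct with the [j]-th coordinate; the
   slices of the basis vectors are the coefficients of the regular comodule. *)
Definition slice j (c : C) : C := sw2 c (fun a b => coord (vbasis {:C}) j b *: a).

Definition regular (i j : 'I_(\dim {:C})) : C := slice j (vbasis {:C})`_i.

Lemma slice_linear j : linear (slice j).
Proof. by rewrite /slice /sw2; linear_tac. Qed.

Lemma slice_comatrix j (I : finType) (t : I -> I -> C) p q : comatrix t ->
  slice j (t p q) = \sum_k coord (vbasis {:C}) j (t k q) *: t p k.
Proof.
move=> tM; rewrite /slice sw2_comatrix //.
- by move=> y a u v; rewrite scalerDr !scalerA mulrC.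
- by move=> y a u v; rewrite linearP scalerDl scalerA.
Qed.

Lemma basis_expand (c : C) :
  c = \sum_i coord (vbasis {:C}) i c *: (vbasis {:C})`_i.
Proof. exact: coord_vbasis (memvf c). Qed.

Lemma slice_regular j c : slice j c = \sum_i coord (vbasis {:C}) i c *: regular i j.
Proof. by rewrite [in LHS](basis_expand c) (lin_comb _ _ (slice_linear j)). Qed.

(** By coassociativity the coproduct of slice_j(e_i) is e_i1 tensor slice_j(e_i2). Expanding the
    second factor by [slice_regular] leaves the first leg contracted with the k-th coordinate of the
    second, which is slice_k(e_i). *)
Lemma regular_comatrix : comatrix regular.
Proof.
move=> i j; split.
  transitivity (tlift (fun x c3 => tlift (fun c1 c2 =>
      coord (vbasis {:C}) j c3 *: (c1 \ox c2)) (comul C x)) (comul C (vbasis {:C})`_i)).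
    rewrite /regular /slice /sw2 linear_tlift; apply: eq_tlift => a b.
    rewrite linearZ /= [X in _ *: X]tensor_span.
    by rewrite (linear_tlift (GRing.scale (coord _ j b))).
  rewrite [LHS]coassoc_multi; try by move=> x y; linear_tac.
    transitivity (tlift (fun a x =>
      \sum_k coord (vbasis {:C}) k x *: (a \ox regular k j)) (comul C (vbasis {:C})`_i)).
      apply: eq_tlift => a x.
      rewrite -(lin_comb _ _ (@tens_linearr _ _ _ a)) -slice_regular.
      pose TC : {linear C -> tensor C C} := HB.pack (fun d : C => a \ox d)
        (GRing.isLinear.Build K C (tensor C C) *:%R _ (tens_linearr a)).
      rewrite -[RHS]/(TC _) /slice /sw2 linear_tlift; apply: eq_tlift => b d.
      by rewrite /TC /= tensZr.
    rewrite /tlift.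
    under eq_bigr => p _ do under eq_bigr => q _ do rewrite scaler_sumr.
    rewrite pair_bigA /= exchange_big; apply: eq_bigr => k _ /=.
    pose TD : {linear C -> tensor C C} := HB.pack (fun d : C => d \ox regular k j)
        (GRing.isLinear.Build K C (tensor C C) *:%R _ (tens_linearl (regular k j))).
    rewrite -[RHS]/(TD (tlift _ _)) linear_tlift [RHS]tlift_pair.
    by apply: eq_bigr => p _; rewrite /TD /= tensZl.
transitivity (coord (vbasis {:C}) j
  (tlift (fun a b => counit C a *: b) (comul C (vbasis {:C})`_i))).
  rewrite (linear_tlift (coord (vbasis {:C}) j : {linear C -> K^o})).
  rewrite /regular /slice /sw2 linear_tlift; apply: eq_tlift => a b.
  by rewrite !linearZ; apply: mulrC.
by rewrite counitl coord_free ?(basis_free (vbasisP _)).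
Qed.

(** The counit is expanded in the dual basis, so the counit axiom writes c as a combination of its
    slices. This shows that the regular coefficients span C, which is what [comatrix_ext] rests
    on. *)
Lemma regular_counit (c : C) :
  c = \sum_(i < \dim {:C}) \sum_(j < \dim {:C})
    (coord (vbasis {:C}) i c * counit C (vbasis {:C})`_j) *: regular i j.
Proof.
rewrite -[LHS]counitr exchange_big /=.
transitivity (\sum_(j < \dim {:C}) counit C (vbasis {:C})`_j *: slice j c); last first.
  apply: eq_bigr => j _; rewrite slice_regular scaler_sumr; apply: eq_bigr => i _.
  by rewrite scalerA mulrC.
rewrite /slice /sw2 /tlift.
under [RHS]eq_bigr => k _ do rewrite scaler_sumr.
rewrite [RHS]exchange_big /=; apply: eq_bigr => i _.
under [RHS]eq_bigr => k _ do rewrite scaler_sumr.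
rewrite [RHS]exchange_big /=; apply: eq_bigr => j _.
under [RHS]eq_bigr => k _.
  rewrite !scalerA coord_free ?(basis_free (vbasisP _)) //.
  rewrite [_ * _%:R]mulrC -scalerA.
  over.
by rewrite sum_deltal scalerA mulrC.
Qed.

Lemma comatrix_ext (U : lmodType K) (f g : C -> U) : linear f -> linear g ->
  (forall (I : finType) (t : I -> I -> C) i j, comatrix t -> f (t i j) = g (t i j)) ->
  f =1 g.
Proof.
move=> lf lg fg c; rewrite (regular_counit c) !lin_sum //.
apply: eq_bigr => i _; rewrite !lin_comb //; apply: eq_bigr => j _.
by rewrite fg //; apply: regular_comatrix.
Qed.

End Comatrix.

(** * The pentagon and its inverse *)

Section MatrixOf.
Variable K : fieldType.

(** On matrix coefficients a convolution product of functionals on a tensor power is a matrix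
    product. Square matrices make it possible to solve the pentagon for any of its factors. *)
Definition mxof (T : finType) (F : T -> T -> K) : 'M[K]_#|T| :=
  \matrix_(a, b) F (enum_val a) (enum_val b).

Lemma eq_mxof (T : finType) (F G : T -> T -> K) : F =2 G -> mxof F = mxof G.
Proof. by move=> FG; apply/matrixP=> a b; rewrite !mxE FG. Qed.

Lemma mxof_mul (T : finType) (F G : T -> T -> K) :
  mxof F *m mxof G = mxof (fun a b => \sum_c F a c * G c b).
Proof.
apply/matrixP=> a b; rewrite !mxE (reindex _ (onW_bij _ (enum_val_bij T))) /=.
by apply: eq_bigr => c _; rewrite !mxE.
Qed.

Lemma mxof_inj (T : finType) (F G : T -> T -> K) : mxof F = mxof G -> F =2 G.
Proof.
move=> /matrixP FG a b; move: (FG (enum_rank a) (enum_rank b)).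
by rewrite !mxE !enum_rankK.
Qed.

Lemma mxof1 (T : finType) : mxof (fun a b : T => (a == b)%:R) = 1%:M.
Proof. by apply/matrixP=> a b; rewrite !mxE (inj_eq enum_val_inj). Qed.

Lemma mxof_tr (T : finType) (F : T -> T -> K) :
  mxof (fun a b => F b a) = (mxof F)^T.
Proof. by apply/matrixP=> a b; rewrite !mxE. Qed.

Definition mxreindex (T T' : finType) (r : T -> T') (M : 'M[K]_#|T'|) : 'M[K]_#|T| :=
  mxof (fun a b => M (enum_rank (r a)) (enum_rank (r b))).

Lemma mxreindex_of (T T' : finType) (r : T -> T') (F : T' -> T' -> K) :
  mxreindex r (mxof F) = mxof (fun a b => F (r a) (r b)).
Proof. by apply: eq_mxof => a b; rewrite mxE !enum_rankK. Qed.

Lemma mxreindexM (T T' : finType) (r : T -> T') (M N : 'M[K]_#|T'|) :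
  bijective r -> mxreindex r (M *m N) = mxreindex r M *m mxreindex r N.
Proof.
move=> rb; rewrite mxof_mul; apply: eq_mxof => a b; rewrite mxE.
by rewrite (reindex _ (onW_bij _ (bij_comp (@enum_rank_bij _) rb))).
Qed.

End MatrixOf.

Section Mx4.
Variables (K : fieldType) (V : lmodType K).

Definition mx4 (I J L M : finType) (t : I -> I -> V) (u : J -> J -> V)
    (v : L -> L -> V) (w : M -> M -> V) (F : V -> V -> V -> V -> K) :=
  mxof (fun a b : I * J * L * M => F (t a.1.1.1 b.1.1.1) (u a.1.1.2 b.1.1.2)
    (v a.1.2 b.1.2) (w a.2 b.2)).

(** Reversing the four arguments is the passage to the opposite algebra. *)
Lemma mx4_rev (I J L M : finType) (t : I -> I -> V) (u : J -> J -> V)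
    (v : L -> L -> V) (w : M -> M -> V) (F : V -> V -> V -> V -> K) :
  mx4 t u v w (fun c d e f => F f e d c) =
  mxreindex (fun a : I * J * L * M => (a.2, a.1.2, a.1.1.2, a.1.1.1))
    (mx4 w v u t F).
Proof. by rewrite mxreindex_of. Qed.

Lemma rev4_bij (I J L M : finType) :
  bijective (fun a : I * J * L * M => (a.2, a.1.2, a.1.1.2, a.1.1.1)).
Proof.
by exists (fun a : M * L * J * I => (a.2, a.1.2, a.1.1.2, a.1.1.1)) => -[[[]]].
Qed.

(** Transposing the comatrices is the passage to the co-opposite coalgebra. *)
Lemma mx4_tr (I J L M : finType) (t : I -> I -> V) (u : J -> J -> V)
    (v : L -> L -> V) (w : M -> M -> V) (F : V -> V -> V -> V -> K) :
  mx4 t u v w F = (mx4 (fun i j => t j i) (fun i j => u j i)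
    (fun i j => v j i) (fun i j => w j i) F)^T.
Proof. by rewrite -mxof_tr. Qed.

Lemma eq_mx4 (I J L M : finType) (t : I -> I -> V) (u : J -> J -> V)
    (v : L -> L -> V) (w : M -> M -> V) (F G : V -> V -> V -> V -> K) :
  (forall c d e f, F c d e f = G c d e f) -> mx4 t u v w F = mx4 t u v w G.
Proof. by move=> FG; apply: eq_mxof => a b; rewrite FG. Qed.

End Mx4.

Lemma sum4 (R : nmodType) (I J L M : finType) (F : I * J * L * M -> R) :
  \sum_x F x = \sum_i \sum_j \sum_k \sum_l F (i, j, k, l).
Proof. by rewrite !pair_bigA; apply: eq_bigr => -[[[]]]. Qed.

Section Inverse.
Variables (K : fieldType) (C : coalgebra K).

Definition inverse3 (P Q : C -> C -> C -> K) : Prop :=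
  forall (I J L : finType) (t : I -> I -> C) (u : J -> J -> C) (v : L -> L -> C),
  comatrix t -> comatrix u -> comatrix v -> forall i i' j j' k k',
  \sum_a \sum_b \sum_c P (t i a) (u j b) (v k c) * Q (t a i') (u b j') (v c k') =
  (i == i')%:R * (j == j')%:R * (k == k')%:R.

Variables (m : C -> C -> C) (P Q : C -> C -> C -> K).
Hypothesis mM : forall (I J : finType) (t : I -> I -> C) (u : J -> J -> C),
  comatrix t -> comatrix u ->
  comatrix (fun p q : I * J => m (t p.1 q.1) (u p.2 q.2)).
Hypothesis PQ : inverse3 P Q.
Variables (I J L M : finType) (t : I -> I -> C) (u : J -> J -> C).
Variables (v : L -> L -> C) (w : M -> M -> C).
Hypotheses (tM : comatrix t) (uM : comatrix u) (vM : comatrix v) (wM : comatrix w).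

Let mx := mx4 t u v w.

(** Composition with the coalgebra morphism given by m on two adjacent factors preserves convolution
    inverses: by [mM] the products of entries form a comatrix indexed by pairs, to which [PQ]
    applies. *)
Lemma mx4_inv12 : mx (fun c d e f => P (m c d) e f) *m
  mx (fun c d e f => Q (m c d) e f) = 1%:M.
Proof.
rewrite mxof_mul -mxof1; apply: eq_mxof => -[[[i j] k] l] [[[i' j'] k'] l'].
rewrite sum4 pair_bigA /= !xpair_eqE -!mulnb !natrM /=.
have := PQ (mM tM uM) vM wM (i, j) (i', j') k k' l l'.
by rewrite xpair_eqE -mulnb natrM.
Qed.

Lemma mx4_inv23 : mx (fun c d e f => P c (m d e) f) *m
  mx (fun c d e f => Q c (m d e) f) = 1%:M.
Proof.
rewrite mxof_mul -mxof1; apply: eq_mxof => -[[[i j] k] l] [[[i' j'] k'] l'].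
rewrite sum4 /= !xpair_eqE -!mulnb !natrM /=.
have := PQ tM (mM uM vM) wM i i' (j, k) (j', k') l l'.
rewrite xpair_eqE -mulnb natrM !mulrA => <-.
by apply: eq_bigr => a _; rewrite pair_bigA.
Qed.

Lemma mx4_inv34 : mx (fun c d e f => P c d (m e f)) *m
  mx (fun c d e f => Q c d (m e f)) = 1%:M.
Proof.
rewrite mxof_mul -mxof1; apply: eq_mxof => -[[[i j] k] l] [[[i' j'] k'] l'].
rewrite sum4 /= !xpair_eqE -!mulnb !natrM /=.
have := PQ tM uM (mM vM wM) i i' j j' (k, l) (k', l').
rewrite xpair_eqE -mulnb natrM !mulrA => <-.
by apply: eq_bigr => a _; apply: eq_bigr => b _; rewrite pair_bigA.
Qed.

Lemma mx4_invl : mx (fun c d e f => counit C c * P d e f) *m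
  mx (fun c d e f => counit C c * Q d e f) = 1%:M.
Proof.
rewrite mxof_mul -mxof1; apply: eq_mxof => -[[[i j] k] l] [[[i' j'] k'] l'].
rewrite sum4 /= !xpair_eqE -!mulnb !natrM -!mulrA (mulrA _ (k == _)%:R).
rewrite -(PQ uM vM wM) -[RHS](sum_deltalK (fun a => (a == i')%:R * _)).
apply: eq_bigr => a _; rewrite !mulr_sumr; apply: eq_bigr => b _.
rewrite !mulr_sumr; apply: eq_bigr => c _; rewrite !mulr_sumr.
by apply: eq_bigr => d _; rewrite !(tM _ _).2 -!mulrA; congr (_ * _); rewrite mulrCA.
Qed.

Lemma mx4_invr : mx (fun c d e f => P c d e * counit C f) *m
  mx (fun c d e f => Q c d e * counit C f) = 1%:M.
Proof.
rewrite mxof_mul -mxof1; apply: eq_mxof => -[[[i j] k] l] [[[i' j'] k'] l'].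
rewrite sum4 /= !xpair_eqE -!mulnb !natrM -(PQ tM uM vM) mulr_suml.
apply: eq_bigr => a _; rewrite mulr_suml; apply: eq_bigr => b _.
rewrite mulr_suml; apply: eq_bigr => c _.
rewrite -[(l == l')%:R](sum_deltalK (fun d => (d == l')%:R)) mulr_sumr.
by apply: eq_bigr => d _; rewrite !(wM _ _).2 mulrACA.
Qed.

End Inverse.

(** * Coquasi Hopf data *)

(* A coquasi Hopf algebra in coordinates, with bijective antipode: [phi] is the
   reassociator, [psi] its convolution inverse and [antipV] the inverse of [antip]. The
   laws are the Sweedler identities evaluated on matrix coefficients, a form
   in which passing to the opposite or co-opposite algebra is a relabelling. *)
Record hopf_data (K : fieldType) (C : coalgebra K) := HopfData {
  mul : C -> C -> C;
  one : C;
  phi : C -> C -> C -> K;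
  psi : C -> C -> C -> K;
  antip : C -> C;
  antipV : C -> C;
  alpha : C -> K;
  beta : C -> K;
  mul_linl : forall y, linear (mul^~ y);
  mul_linr : forall x, linear (mul x);
  phi_lin1 : forall y z, scalar (fun x => phi x y z);
  phi_lin2 : forall x z, scalar (fun y => phi x y z);
  phi_lin3 : forall x y, scalar (fun z => phi x y z);
  psi_lin1 : forall y z, scalar (fun x => psi x y z);
  psi_lin2 : forall x z, scalar (fun y => psi x y z);
  psi_lin3 : forall x y, scalar (fun z => psi x y z);
  S_lin : linear antip;
  Sb_lin : linear antipV;
  al_lin : scalar alpha;
  be_lin : scalar beta;
  mul_comatrix : forall (I J : finType) (t : I -> I -> C) (u : J -> J -> C),
    comatrix t -> comatrix u ->
    comatrix (fun p q : I * J => mul (t p.1 q.1) (u p.2 q.2));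
  one_comatrix : comatrix (fun _ _ : unit => one);
  S_comatrix : forall (I : finType) (t : I -> I -> C),
    comatrix t -> comatrix (fun i j => antip (t j i));
  Sb_comatrix : forall (I : finType) (t : I -> I -> C),
    comatrix t -> comatrix (fun i j => antipV (t j i));
  SK : cancel antip antipV;
  SbK : cancel antipV antip;
  mul1c : forall c, mul one c = c;
  mulc1 : forall c, mul c one = c;
  phi_one : forall c d, phi c one d = counit C c * counit C d;
  psi_one : forall c d, psi c one d = counit C c * counit C d;
  phiK : inverse3 phi psi;
  psiK : inverse3 psi phi;
  quasi_assoc : forall (I J L : finType) (t : I -> I -> C) (u : J -> J -> C)
      (v : L -> L -> C), comatrix t -> comatrix u -> comatrix v ->
    forall i i' j j' k k',
    \sum_a \sum_b \sum_c phi (t a i') (u b j') (v c k') *: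
      mul (mul (t i a) (u j b)) (v k c) =
    \sum_a \sum_b \sum_c phi (t i a) (u j b) (v k c) *:
      mul (t a i') (mul (u b j') (v c k'));
  quasi_assocV : forall (I J L : finType) (t : I -> I -> C) (u : J -> J -> C)
      (v : L -> L -> C), comatrix t -> comatrix u -> comatrix v ->
    forall i i' j j' k k',
    \sum_a \sum_b \sum_c psi (t a i') (u b j') (v c k') *:
      mul (t i a) (mul (u j b) (v k c)) =
    \sum_a \sum_b \sum_c psi (t i a) (u j b) (v k c) *:
      mul (mul (t a i') (u b j')) (v c k');
  pentagon : forall (I J L M : finType) (t : I -> I -> C) (u : J -> J -> C)
      (v : L -> L -> C) (w : M -> M -> C),
    comatrix t -> comatrix u -> comatrix v -> comatrix w ->
    mx4 t u v w (fun c d e f => phi (mul c d) e f) *m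
    mx4 t u v w (fun c d e f => phi c d (mul e f)) =
    mx4 t u v w (fun c d e f => phi c d e * counit C f) *m
    mx4 t u v w (fun c d e f => phi c (mul d e) f) *m
    mx4 t u v w (fun c d e f => counit C c * phi d e f);
  pentagonV : forall (I J L M : finType) (t : I -> I -> C) (u : J -> J -> C)
      (v : L -> L -> C) (w : M -> M -> C),
    comatrix t -> comatrix u -> comatrix v -> comatrix w ->
    mx4 t u v w (fun c d e f => psi c d (mul e f)) *m
    mx4 t u v w (fun c d e f => psi (mul c d) e f) =
    mx4 t u v w (fun c d e f => counit C c * psi d e f) *m
    mx4 t u v w (fun c d e f => psi c (mul d e) f) *m
    mx4 t u v w (fun c d e f => psi c d e * counit C f);
  antipode_al : forall (I : finType) (t : I -> I -> C), comatrix t ->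
    forall i l, \sum_j \sum_k alpha (t j k) *: mul (antip (t i j)) (t k l) =
    alpha (t i l) *: one;
  antipode_be : forall (I : finType) (t : I -> I -> C), comatrix t ->
    forall i l, \sum_j \sum_k beta (t j k) *: mul (t i j) (antip (t k l)) =
    beta (t i l) *: one;
  antipode_psi : forall (I : finType) (t : I -> I -> C), comatrix t ->
    forall i n, \sum_j \sum_k \sum_l \sum_m
      psi (t i j) (antip (t k l)) (t m n) * beta (t j k) * alpha (t l m) = (i == n)%:R;
  antipode_phi : forall (I : finType) (t : I -> I -> C), comatrix t ->
    forall i n, \sum_j \sum_k \sum_l \sum_m
      phi (antip (t i j)) (t k l) (antip (t m n)) * alpha (t j k) * beta (t l m) =
    (i == n)%:R
}.

(** * The opposite and co-opposite of coquasi Hopf data *)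

Section Opposites.
Variables (K : fieldType) (C : coalgebra K) (D : hopf_data C).

Lemma cop_comatrix (I : finType) (t : I -> I -> C) :
  @comatrix K C I t -> @comatrix K (cop_coalg C) I (fun i j => t j i).
Proof.
move=> tM i j; split; last by rewrite [LHS](tM j i).2 eq_sym.
rewrite [LHS](sw2_comatrix _ _ tM) //; first by move=> y; linear_tac.
by move=> y; linear_tac.
Qed.

Lemma comatrix_cop (I : finType) (t : I -> I -> cop_coalg C) :
  @comatrix K (cop_coalg C) I t -> @comatrix K C I (fun i j => t j i).
Proof.
move=> tM i j; split; last by rewrite [LHS](tM j i).2 eq_sym.
transitivity (tlift (fun a b : C => b \ox a) (cop_comul (t j i : C))).
  rewrite tlift_cop; first exact: tensor_span.
    by move=> y; linear_tac.
  by move=> y; linear_tac.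
rewrite [cop_comul _](tM j i).1 linear_sum; apply: eq_bigr => k _.
by apply: (@tlift_tens _ C C) => ?; linear_tac.
Qed.

(** Reversing the product exchanges phi and psi with reversed arguments, and the antipode becomes
    its inverse. Evaluating the laws of D at S^-1(h) shows that alpha and beta must be composed with
    S^-1. The definition is transparent so that results applied to [op_data D] can be read as
    statements about D by conversion. *)
Definition op_data : hopf_data C.
Proof.
refine (@HopfData K C (fun x y => mul D y x) (one D)
  (fun x y z => psi D z y x) (fun x y z => phi D z y x) (antipV D) (antip D)
  (fun x => alpha D (antipV D x)) (fun x => beta D (antipV D x))
  (mul_linr D) (mul_linl D)
  (fun y z => psi_lin3 D z y) (fun x z => psi_lin2 D z x)
  (fun x y => psi_lin1 D y x)
  (fun y z => phi_lin3 D z y) (fun x z => phi_lin2 D z x)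
  (fun x y => phi_lin1 D y x) (@Sb_lin _ _ D) (@S_lin _ _ D) _ _ _
  (one_comatrix D) (@Sb_comatrix _ _ D) (@S_comatrix _ _ D) (@SbK _ _ D)
  (@SK _ _ D) (@mulc1 _ _ D) (@mul1c _ _ D) _ _ _ _ _ _ _ _ _ _ _ _).
- by move=> a x y; rewrite Sb_lin al_lin.
- by move=> a x y; rewrite Sb_lin be_lin.
- move=> I J t u tM uM p q; have := mul_comatrix D uM tM => M.
  have [Mc Me] := M (p.2, p.1) (q.2, q.1); split.
    rewrite Mc (reindex (fun k : I * J => (k.2, k.1))) //.
    by exists (fun k : J * I => (k.2, k.1)) => -[].
  by rewrite Me -!pair_eqE /pair_eq /= andbC.
- by move=> c d; rewrite psi_one mulrC.
- by move=> c d; rewrite phi_one mulrC.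
- move=> I J L t u v tM uM vM i i' j j' k k'.
  pull_sum 2%N; under [LHS]eq_bigr do rewrite exchange_big /=.
  by rewrite (psiK D vM uM tM) mulrC [_ * (j == _)%:R]mulrC mulrA.
- move=> I J L t u v tM uM vM i i' j j' k k'.
  pull_sum 2%N; under [LHS]eq_bigr do rewrite exchange_big /=.
  by rewrite (phiK D vM uM tM) mulrC [_ * (j == _)%:R]mulrC mulrA.
- move=> I J L t u v tM uM vM i i' j j' k k'.
  pull_sum 2%N; under [LHS]eq_bigr do rewrite exchange_big /=.
  rewrite (quasi_assocV D vM uM tM).
  pull_sum 2%N; apply: eq_bigr => a _.
  by rewrite exchange_big; apply: eq_bigr.
- move=> I J L t u v tM uM vM i i' j j' k k'.
  pull_sum 2%N; under [LHS]eq_bigr do rewrite exchange_big /=.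
  rewrite (quasi_assoc D vM uM tM).
  pull_sum 2%N; apply: eq_bigr => a _.
  by rewrite exchange_big; apply: eq_bigr.
- move=> I J L M t u v w tM uM vM wM.
  have /(congr1 (mxreindex (fun a : I * J * L * M => (a.2, a.1.2, a.1.1.2, a.1.1.1))))
    := pentagonV D wM vM uM tM.
  rewrite !mxreindexM; try exact: rev4_bij.
  rewrite -!mx4_rev => ->; congr (_ *m _ *m _); apply: eq_mx4 => *; exact: mulrC.
- move=> I J L M t u v w tM uM vM wM.
  have /(congr1 (mxreindex (fun a : I * J * L * M => (a.2, a.1.2, a.1.1.2, a.1.1.1))))
    := pentagon D wM vM uM tM.
  rewrite !mxreindexM; try exact: rev4_bij.
  rewrite -!mx4_rev => ->; congr (_ *m _ *m _); apply: eq_mx4 => *; exact: mulrC.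
- move=> I t tM i l; rewrite exchange_big /=.
  rewrite -(antipode_al D (Sb_comatrix D tM)); apply: eq_bigr => j _.
  by apply: eq_bigr => k _; rewrite SbK.
- move=> I t tM i l; rewrite exchange_big /=.
  rewrite -(antipode_be D (Sb_comatrix D tM)); apply: eq_bigr => j _.
  by apply: eq_bigr => k _; rewrite SbK.
- move=> I t tM i l; rewrite eq_sym.
  rewrite -(antipode_phi D (Sb_comatrix D tM)).
  pull_sum 3%N; apply: eq_bigr => j _.
  pull_sum 2%N; apply: eq_bigr => k _.
  pull_sum 1%N; apply: eq_bigr => m _; apply: eq_bigr => n _.
  by rewrite !SbK mulrAC.
- move=> I t tM i l; rewrite eq_sym.
  rewrite -(antipode_psi D (Sb_comatrix D tM)).
  pull_sum 3%N; apply: eq_bigr => j _.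
  pull_sum 2%N; apply: eq_bigr => k _.
  pull_sum 1%N; apply: eq_bigr => m _; apply: eq_bigr => n _.
  by rewrite !SbK mulrAC.
Defined.

(** Here the product is kept while the legs of coproducts are exchanged, so phi and psi swap without
    reversal, and so do alpha and beta after composition with S^-1. *)
Definition cop_data : hopf_data (cop_coalg C).
Proof.
refine (@HopfData K (cop_coalg C) (mul D) (one D) (psi D) (phi D) (antipV D) (antip D)
  (fun x => beta D (antipV D x)) (fun x => alpha D (antipV D x))
  (mul_linl D) (mul_linr D) (psi_lin1 D) (psi_lin2 D) (psi_lin3 D)
  (phi_lin1 D) (phi_lin2 D) (phi_lin3 D) (@Sb_lin _ _ D) (@S_lin _ _ D) _ _ _ _
  _ _ (@SbK _ _ D) (@SK _ _ D) (@mul1c _ _ D) (@mulc1 _ _ D)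
  (psi_one D) (phi_one D) _ _ _ _ _ _ _ _ _ _).
- by move=> a x y; rewrite Sb_lin be_lin.
- by move=> a x y; rewrite Sb_lin al_lin.
- move=> I J t u /comatrix_cop tM /comatrix_cop uM.
  exact: (cop_comatrix (mul_comatrix D tM uM)).
- exact: (cop_comatrix (one_comatrix D)).
- move=> I t /comatrix_cop tM; exact: (cop_comatrix (Sb_comatrix D tM)).
- move=> I t /comatrix_cop tM; exact: (cop_comatrix (S_comatrix D tM)).
- move=> I J L t u v /comatrix_cop tM /comatrix_cop uM /comatrix_cop vM.
  move=> i i' j j' k k'; rewrite (eq_sym i) (eq_sym j) (eq_sym k).
  rewrite -(phiK D tM uM vM); apply: eq_bigr => a _; apply: eq_bigr => b _.
  by apply: eq_bigr => c _; rewrite mulrC.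
- move=> I J L t u v /comatrix_cop tM /comatrix_cop uM /comatrix_cop vM.
  move=> i i' j j' k k'; rewrite (eq_sym i) (eq_sym j) (eq_sym k).
  rewrite -(psiK D tM uM vM); apply: eq_bigr => a _; apply: eq_bigr => b _.
  by apply: eq_bigr => c _; rewrite mulrC.
- move=> I J L t u v /comatrix_cop tM /comatrix_cop uM /comatrix_cop vM.
  move=> i i' j j' k k'; exact/esym/(quasi_assocV D tM uM vM).
- move=> I J L t u v /comatrix_cop tM /comatrix_cop uM /comatrix_cop vM.
  move=> i i' j j' k k'; exact/esym/(quasi_assoc D tM uM vM).
- move=> I J L M t u v w /comatrix_cop tM /comatrix_cop uM /comatrix_cop vM
    /comatrix_cop wM.
  by rewrite !(mx4_tr t u v w) -!trmx_mul (pentagonV D tM uM vM wM) !trmx_mul mulmxA.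
- move=> I J L M t u v w /comatrix_cop tM /comatrix_cop uM /comatrix_cop vM
    /comatrix_cop wM.
  by rewrite !(mx4_tr t u v w) -!trmx_mul (pentagon D tM uM vM wM) !trmx_mul mulmxA.
- move=> I t /comatrix_cop/(Sb_comatrix D) tM i l; rewrite -(antipode_be D tM).
  by apply: eq_bigr => j _; apply: eq_bigr => k _; rewrite SbK.
- move=> I t /comatrix_cop/(Sb_comatrix D) tM i l; rewrite -(antipode_al D tM).
  by apply: eq_bigr => j _; apply: eq_bigr => k _; rewrite SbK.
- move=> I t /comatrix_cop/(Sb_comatrix D) tM i l; rewrite -(antipode_phi D tM).
  do 4!apply: eq_bigr => ? _; by rewrite !SbK mulrAC.
- move=> I t /comatrix_cop/(Sb_comatrix D) tM i l; rewrite -(antipode_psi D tM).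
  do 4!apply: eq_bigr => ? _; by rewrite !SbK mulrAC.
Defined.

End Opposites.

(** * The pentagon solved for one side, and bending with the antipode *)

Section Theory.
Variables (K : fieldType) (C : coalgebra K) (D : hopf_data C).
Notation mul := (mul D).
Notation one := (one D).
Notation phi := (phi D).
Notation psi := (psi D).
Notation antip := (antip D).
Notation antipV := (antipV D).
Notation alpha := (alpha D).
Notation beta := (beta D).
Notation eps := (counit C).

Section Pentagon.
Variables (I J L M : finType) (t : I -> I -> C) (u : J -> J -> C).
Variables (v : L -> L -> C) (w : M -> M -> C).
Hypotheses (tM : comatrix t) (uM : comatrix u) (vM : comatrix v) (wM : comatrix w).

Let mx := mx4 t u v w.

(** The pentagon multiplied by three inverses. In this form a product of one psi and one phi
    acquires, on the right, a product in the last argument of phi and another in the middle argument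
    of psi: the places where S(y) y and y S(y) will collapse. *)
Lemma mx4_pentagon :
  mx (fun c d e f => psi (mul c d) e f) *m
  mx (fun c d e f => phi c d e * eps f) =
  mx (fun c d e f => phi c d (mul e f)) *m
  mx (fun c d e f => eps c * psi d e f) *m
  mx (fun c d e f => psi c (mul d e) f).
Proof.
have mM := mul_comatrix D.
rewrite -[_ *m mx (fun c d e f => _ * eps f)]mulmx1.
rewrite -{1}(mx4_inv23 mM (phiK D) tM uM vM wM).
rewrite -[mx4 _ _ _ _ (fun c d e f => phi c _ f)]mulmx1.
rewrite -{1}(mx4_invl (phiK D) tM uM vM wM).
have := pentagon D tM uM vM wM; rewrite -/mx => P.
rewrite !mulmxA -(mulmxA (mx (fun c d e f => psi (mul c d) e f))).
rewrite -(mulmxA (mx (fun c d e f => psi (mul c d) e f))) -P !mulmxA.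
by rewrite (mx4_inv12 mM (psiK D) tM uM vM wM) mul1mx.
Qed.

Lemma pentagon_cancel i i' j j' k k' l l' :
  \sum_a \sum_b \sum_c psi (mul (t i a) (u j b)) (v k c) (w l l') *
     phi (t a i') (u b j') (v c k') =
  \sum_a \sum_b1 \sum_c1 \sum_d1 \sum_b2 \sum_c2 \sum_d2
    phi (t i a) (u j b1) (mul (v k c1) (w l d1)) *
    psi (u b1 b2) (v c1 c2) (w d1 d2) *
    psi (t a i') (mul (u b2 j') (v c2 k')) (w d2 l').
Proof.
have := mx4_pentagon; rewrite /mx !mxof_mul => /mxof_inj /(_ (i, j, k, l) (i', j', k', l')).
rewrite sum4 /= => E.
transitivity (\sum_a \sum_b \sum_c \sum_d psi (mul (t i a) (u j b)) (v k c) (w l d) *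
     (phi (t a i') (u b j') (v c k') * eps (w d l'))).
  do 3!apply: eq_bigr => ? _; under [RHS]eq_bigr do rewrite (wM _ _).2 mulrA mulrC.
  by rewrite sum_deltarK.
rewrite {}E sum4 /=; under [LHS]eq_bigr => a _ do
  under eq_bigr => b _ do under eq_bigr => c _ do under eq_bigr => d _ do rewrite sum4 /=.
flat_sums.
pull_sum 4%N; apply: eq_bigr => a _; pull_sum 4%N; apply: eq_bigr => b1 _.
pull_sum 4%N; apply: eq_bigr => c1 _; pull_sum 4%N; apply: eq_bigr => d1 _.
pull_sum 1%N; apply: eq_bigr => b2 _; pull_sum 1%N; apply: eq_bigr => c2 _.
pull_sum 1%N; apply: eq_bigr => d2 _.
under [LHS]eq_bigr => a2 _ do rewrite (tM _ _).2 mulrCA -mulrA.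
by rewrite sum_deltalK.
Qed.

End Pentagon.
(* [qform] bends the right leg of a bilinear map, and [rform] unbends it. They and
   [conv2] below are locked, lest rewriting with lemmas on sums unfold the
   Sweedler sums they contain. *)
Definition qform (x y : C) : K :=
  locked (sw3 y (fun y1 y2 y3 => beta y2 * phi x y1 (antip y3) : K^o)).

Definition rform (x y : C) : K :=
  locked (sw3 y (fun y1 y2 y3 => alpha y2 * psi x (antip y1) y3 : K^o)).

Lemma qform_comatrix (J : finType) (u : J -> J -> C) x j j' : comatrix u ->
  qform x (u j j') = \sum_a \sum_b beta (u a b) * phi x (u j a) (antip (u b j')).
Proof.
move=> uM; rewrite /qform -lock sw3_comatrix // => y z a c d.
- by rewrite phi_lin2 mulrDr mulrCA.
- by rewrite be_lin mulrDl -mulrA.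
- by rewrite S_lin phi_lin3 mulrDr mulrCA.
Qed.

Lemma rform_comatrix (J : finType) (u : J -> J -> C) x j j' : comatrix u ->
  rform x (u j j') = \sum_a \sum_b alpha (u a b) * psi x (antip (u j a)) (u b j').
Proof.
move=> uM; rewrite /rform -lock sw3_comatrix // => y z a c d.
- by rewrite S_lin psi_lin2 mulrDr mulrCA.
- by rewrite al_lin mulrDl -mulrA.
- by rewrite psi_lin3 mulrDr mulrCA.
Qed.

Section Bending.
Variables (I J : finType) (t : I -> I -> C) (u : J -> J -> C).
Hypotheses (tM : comatrix t) (uM : comatrix u).

(** [quasi_assoc] brings the two y-factors together as y S(y) with beta in between, and the antipode
    law collapses them to the unit; what remains of phi and beta is again [qform]. *)
Lemma qform_bend i i' j j' :
  \sum_a \sum_b \sum_c qform (t a i') (u b c) *: mul (mul (t i a) (u j b)) (antip (u c j')) =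
  \sum_a qform (t i a) (u j j') *: t a i'.
Proof.
under [LHS]eq_bigr => a _ do under eq_bigr => b _ do under eq_bigr => c _ do
  rewrite qform_comatrix //.
flat_sums; pull_sum 3%N.
transitivity (\sum_d \sum_e beta (u d e) *: \sum_a \sum_b \sum_c
    phi (t a i') (u b d) (antip (u e c)) *: mul (mul (t i a) (u j b)) (antip (u c j'))).
  apply: eq_bigr => d _; pull_sum 3%N; apply: eq_bigr => e _; apply/esym.
  by flat_sums; do 3!apply: eq_bigr => ? _; rewrite scalerA.
under [LHS]eq_bigr => d _ do under eq_bigr => e _ do
  rewrite (quasi_assoc D tM uM (S_comatrix D uM)).
flat_sums; pull_sum 2%N.
apply: eq_bigr => a _; rewrite qform_comatrix // scaler_suml.
pull_sum 2%N; apply: eq_bigr => b _; rewrite scaler_suml; pull_sum 2%N.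
apply: eq_bigr => c _; have E := antipode_be D uM b c.
under [LHS]eq_bigr => d _ do under eq_bigr => e _ do rewrite scalerA mulrC -scalerA.
under [LHS]eq_bigr => d _ do rewrite -scaler_sumr.
rewrite -scaler_sumr.
under [X in _ *: X]eq_bigr => d _ do rewrite -(lin_comb _ _ (mul_linr D _)).
rewrite -(lin_sum _ (mul_linr D _)) E (linZ _ _ (mul_linr D _)) mulc1.
by rewrite scalerA mulrC.
Qed.

Lemma antipode_al_scal (F : C -> K) i l : scalar F ->
  \sum_j \sum_k alpha (u j k) * F (mul (antip (u i j)) (u k l)) = alpha (u i l) * F one.
Proof.
move=> lF; rewrite -(scalZ _ _ lF) -(antipode_al D uM).
rewrite (@lin_sum K C K^o F _ _ lF); apply: eq_bigr => j _; exact/esym/scal_comb.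
Qed.

Lemma antipode_be_scal (F : C -> K) i l : scalar F ->
  \sum_j \sum_k beta (u j k) * F (mul (u i j) (antip (u k l))) = beta (u i l) * F one.
Proof.
move=> lF; rewrite -(scalZ _ _ lF) -(antipode_be D uM).
rewrite (@lin_sum K C K^o F _ _ lF); apply: eq_bigr => j _; exact/esym/scal_comb.
Qed.

(* A zigzag identity for the dual of the comodule [u]. *)
Lemma rform_qform i i' j j' :
  \sum_a \sum_b \sum_c rform (mul (t i a) (u j b)) (u c j') * qform (t a i') (u b c) =
  phi (t i i') (u j j') one.
Proof.
transitivity (\sum_d \sum_e \sum_f \sum_g (alpha (u d e) * beta (u f g)) *
   \sum_a \sum_b \sum_c psi (mul (t i a) (u j b)) (antip (u c d)) (u e j') *
      phi (t a i') (u b f) (antip (u g c))).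
  under [LHS]eq_bigr => a _ do under eq_bigr => b _ do under eq_bigr => c _ do
    rewrite rform_comatrix // qform_comatrix //.
  flat_sums; pull_sum 5%N; apply: eq_bigr => d _; pull_sum 5%N; apply: eq_bigr => e _.
  pull_sum 3%N; apply: eq_bigr => f _; pull_sum 3%N; apply: eq_bigr => g _.
  rewrite mulr_sumr; apply: eq_bigr => a _; rewrite mulr_sumr; apply: eq_bigr => b _.
  by rewrite mulr_sumr; apply: eq_bigr => c _; rewrite mulrACA.
(* [pentagon_cancel] separates alpha from beta: the alpha-sum now meets S(y) y in the last argument
   of phi, the beta-sum meets y S(y) in the middle argument of psi. Both collapse to the unit, the
   second psi becomes a product of counits, and the remaining psi with alpha and beta is the axiom
   [antipode_psi]. *)
transitivity (\sum_a \sum_b1 \sum_c1 \sum_d1 \sum_b2 \sum_c2 \sum_d2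
  psi (u b1 b2) (antip (u c2 c1)) (u d1 d2) *
    ((\sum_d \sum_e alpha (u d e) * phi (t i a) (u j b1) (mul (antip (u c1 d)) (u e d1))) *
     (\sum_f \sum_g beta (u f g) * psi (t a i') (mul (u b2 f) (antip (u g c2))) (u d2 j')))).
  under [LHS]eq_bigr => d _ do under eq_bigr => e _ do under eq_bigr => f _ do
    under eq_bigr => g _ do rewrite (pentagon_cancel tM uM (S_comatrix D uM) uM).
  flat_sums.
  do 7!(pull_sum 4%N; apply: eq_bigr => ? _).
  apply/esym; flat_sums; pull_sum 2%N; apply: eq_bigr => d _; pull_sum 2%N.
  apply: eq_bigr => e _; apply: eq_bigr => f _; apply: eq_bigr => g _.
  ring.
under [LHS]eq_bigr => a _ do under eq_bigr => b _ do under eq_bigr => c _ do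
  under eq_bigr => d _ do under eq_bigr => b2 _ do under eq_bigr => c2 _ do
  under eq_bigr => d2 _ do
    rewrite (antipode_al_scal _ _ (phi_lin3 D _ _))
      (antipode_be_scal _ _ (psi_lin2 D _ _)) psi_one (tM _ _).2 (uM _ _).2.
transitivity (\sum_a \sum_b (a == i')%:R * (b == j')%:R * phi (t i a) (u j b) one).
  apply: eq_bigr => a _; apply: eq_bigr => b _; rewrite -(antipode_psi D uM) mulr_sumr mulr_suml.
  pull_sum 2%N; apply: eq_bigr => b2 _; rewrite mulr_sumr mulr_suml.
  pull_sum 2%N; apply: eq_bigr => c2 _; rewrite mulr_sumr mulr_suml.
  apply: eq_bigr => c _; rewrite mulr_sumr mulr_suml.
  apply: eq_bigr => d _.
  rewrite -[in RHS](sum_deltarK (fun d2 => psi (u b b2) (antip (u c2 c)) (u d d2)) j').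
  apply/esym; flat_sums; apply: eq_bigr => d2 _; ring.
under [LHS]eq_bigr => a _ do under eq_bigr => b _ do rewrite -mulrA.
by under [LHS]eq_bigr => a _ do rewrite -mulr_sumr sum_deltarK; rewrite sum_deltarK.
Qed.

End Bending.

End Theory.

Lemma eq_sw2 (K : fieldType) (C : coalgebra K) (c : C) (F G : C -> C -> K) :
  (forall a b, F a b = G a b) ->
  sw2 c (F : C -> C -> K^o) = sw2 c (G : C -> C -> K^o) :> K.
Proof. by move=> FG; apply: (@eq_tlift K C C K^o). Qed.

(** * Bilinear forms and their convolution *)

Section Scalar.
Variables (K : fieldType) (U V W : lmodType K) (C : coalgebra K).

Lemma scalar_mull (f : U -> K) k : scalar f -> scalar (fun x => f x * k).
Proof. by move=> lf a x y; rewrite lf mulrDl mulrA. Qed.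

Lemma scalar_mulr (f : U -> K) k : scalar f -> scalar (fun x => k * f x).
Proof. by move=> lf a x y; rewrite lf mulrDr mulrCA. Qed.

Lemma scalar_sum (I : finType) (F : I -> U -> K) :
  (forall i, scalar (F i)) -> scalar (fun x => \sum_i F i x).
Proof.
move=> lF a x y; rewrite mulr_sumr -big_split.
by apply: eq_bigr => i _; rewrite lF.
Qed.

Lemma scalar_comp (f : V -> K) (g : U -> V) :
  scalar f -> linear g -> scalar (fun x => f (g x)).
Proof. by move=> lf lg a x y; rewrite lg lf. Qed.

Lemma linear_comp (f : V -> W) (g : U -> V) :
  linear f -> linear g -> linear (fun x => f (g x)).
Proof. by move=> lf lg a x y; rewrite lg lf. Qed.

Lemma linear_scale_scalar (f : U -> K) (v : V) :
  scalar f -> linear (fun x => f x *: v).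
Proof. by move=> lf a x y; rewrite lf scalerDl scalerA. Qed.

Lemma scalar_sw2 (F : U -> C -> C -> K) c :
  (forall a b, scalar (fun x => F x a b)) ->
  scalar (fun x => sw2 c (F x : C -> C -> K^o) : K).
Proof. by move=> lF; apply: (@linear_tliftF K C C K^o). Qed.

Lemma scalar_sw2_arg (F : C -> C -> K) (g : U -> C) :
  linear g -> scalar (fun x => sw2 (g x) (F : C -> C -> K^o) : K).
Proof.
by move=> lg a x y; rewrite /sw2 lg !linearP.
Qed.

Lemma scalar_sw3 (F : U -> C -> C -> C -> K) c :
  (forall a b d, scalar (fun x => F x a b d)) ->
  scalar (fun x => sw3 c (F x : C -> C -> C -> K^o) : K).
Proof.
move=> lF; apply: (scalar_sw2 (F := fun x z c3 => sw2 z (fun c1 c2 => F x c1 c2 c3 : K^o))).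
by move=> a b; apply: scalar_sw2.
Qed.

Lemma scalar_sw3_arg (F : C -> C -> C -> K) (g : U -> C) :
  linear g -> scalar (fun x => sw3 (g x) (F : C -> C -> C -> K^o) : K).
Proof. exact: scalar_sw2_arg. Qed.

End Scalar.

Section DataScalar.
Variables (K : fieldType) (U : lmodType K) (C : coalgebra K) (D : hopf_data C).

Lemma phi_sc1 (g : U -> C) y z : linear g -> scalar (fun x => phi D (g x) y z).
Proof. exact: scalar_comp (phi_lin1 D y z). Qed.
Lemma phi_sc2 (g : U -> C) y z : linear g -> scalar (fun x => phi D y (g x) z).
Proof. exact: scalar_comp (phi_lin2 D y z). Qed.
Lemma phi_sc3 (g : U -> C) y z : linear g -> scalar (fun x => phi D y z (g x)).
Proof. exact: scalar_comp (phi_lin3 D y z). Qed.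
Lemma psi_sc1 (g : U -> C) y z : linear g -> scalar (fun x => psi D (g x) y z).
Proof. exact: scalar_comp (psi_lin1 D y z). Qed.
Lemma psi_sc2 (g : U -> C) y z : linear g -> scalar (fun x => psi D y (g x) z).
Proof. exact: scalar_comp (psi_lin2 D y z). Qed.
Lemma psi_sc3 (g : U -> C) y z : linear g -> scalar (fun x => psi D y z (g x)).
Proof. exact: scalar_comp (psi_lin3 D y z). Qed.
Lemma be_sc (g : U -> C) : linear g -> scalar (fun x => beta D (g x)).
Proof. exact: scalar_comp (@be_lin _ _ D). Qed.
Lemma mul_l1 (g : U -> C) y : linear g -> linear (fun x => mul D (g x) y).
Proof. exact: linear_comp (mul_linl D y). Qed.
Lemma mul_l2 (g : U -> C) y : linear g -> linear (fun x => mul D y (g x)).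
Proof. exact: linear_comp (mul_linr D y). Qed.
Lemma S_l (g : U -> C) : linear g -> linear (fun x => antip D (g x)).
Proof. exact: linear_comp (@S_lin _ _ D). Qed.
Lemma qform_sc1 (g : U -> C) y : linear g -> scalar (fun x => qform D (g x) y).
Proof.
move=> lg k v w; rewrite /qform -!lock.
apply: (scalar_sw3 (F := fun x y1 y2 y3 => beta D y2 * phi D (g x) y1 (antip D y3))).
by move=> a b d; apply/scalar_mulr/phi_sc1.
Qed.

Lemma qform_sc2 (g : U -> C) y : linear g -> scalar (fun x => qform D y (g x)).
Proof.
move=> lg k v w; rewrite /qform -!lock.
exact: (scalar_sw3_arg (fun y1 y2 y3 => beta D y2 * phi D y y1 (antip D y3))).
Qed.

Lemma rform_sc1 (g : U -> C) y : linear g -> scalar (fun x => rform D (g x) y).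
Proof.
move=> lg k v w; rewrite /rform -!lock.
apply: (scalar_sw3 (F := fun x y1 y2 y3 => alpha D y2 * psi D (g x) (antip D y1) y3)).
by move=> a b d; apply/scalar_mulr/psi_sc1.
Qed.

Lemma rform_sc2 (g : U -> C) y : linear g -> scalar (fun x => rform D y (g x)).
Proof.
move=> lg k v w; rewrite /rform -!lock.
exact: (scalar_sw3_arg (fun y1 y2 y3 => alpha D y2 * psi D y (antip D y1) y3)).
Qed.

End DataScalar.

Section Conv2.
Variables (K : fieldType) (C : coalgebra K).
Implicit Types F G : C -> C -> K.

Definition biscalar F := (forall y, scalar (F^~ y)) /\ (forall x, scalar (F x)).

Definition conv2 F G (x y : C) : K :=
  locked (sw2 x (fun x1 x2 => sw2 y (fun y1 y2 => F x1 y1 * G x2 y2 : K^o))).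

Lemma conv2_biscalar F G : biscalar (conv2 F G).
Proof.
split=> [y|x] k v w; rewrite /conv2 -!lock.
  exact: (scalar_sw2_arg (fun x1 x2 => sw2 y (fun y1 y2 => F x1 y1 * G x2 y2 : K^o))
    (@linear_id K C) k v w).
refine (scalar_sw2 (F := fun y x1 x2 => sw2 y (fun y1 y2 => F x1 y1 * G x2 y2 : K^o))
  x _ k v w).
by move=> a b; apply: scalar_sw2_arg.
Qed.

Lemma conv2_comatrix F G (I J : finType) (t : I -> I -> C) (u : J -> J -> C)
    i i' j j' : biscalar F -> biscalar G -> comatrix t -> comatrix u ->
  conv2 F G (t i i') (u j j') =
  \sum_a \sum_b F (t i a) (u j b) * G (t a i') (u b j').
Proof.
move=> [F1 F2] [G1 G2] tM uM; rewrite /conv2 -lock sw2_comatrix //.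
- apply: eq_bigr => a _; rewrite sw2_comatrix // => y.
    exact/scalar_mull/F2.
  exact/scalar_mulr/G2.
- by move=> y; apply: scalar_sw2 => a b; apply/scalar_mull/F1.
- by move=> x; apply: scalar_sw2 => a b; apply/scalar_mulr/G1.
Qed.

End Conv2.

Lemma sw2_cop (K : fieldType) (C : coalgebra K) (U : lmodType K)
    (F : C -> C -> U) c :
  (forall y, linear (F^~ y)) -> (forall x, linear (F x)) ->
  @sw2 K (cop_coalg C) U c F = @sw2 K C U c (fun x y => F y x).
Proof. exact: tlift_cop. Qed.

Lemma conv2_cop (K : fieldType) (C : coalgebra K) (F G : C -> C -> K) x y :
  biscalar F -> biscalar G ->
  @conv2 K (cop_coalg C) F G x y = @conv2 K C G F x y.
Proof.
move=> [F1 F2] [G1 G2]; rewrite /conv2 -!lock.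
transitivity (@sw2 K (cop_coalg C) K^o x (fun x1 x2 =>
  sw2 (y : C) (fun y1 y2 => G x2 y1 * F x1 y2 : K^o))).
  apply: eq_sw2 => x1 x2; rewrite sw2_cop => [|z|z].
  - by apply: eq_sw2 => y1 y2; apply: mulrC.
  - exact/scalar_mull/F2.
  - exact/scalar_mulr/G2.
rewrite [LHS]sw2_cop // => z.
  by apply: scalar_sw2 => a b; apply/scalar_mulr/F1.
by apply: scalar_sw2 => a b; apply/scalar_mull/G1.
Qed.

(** * Invariant forms *)

Section RightInvariant.
Variables (K : fieldType) (C : coalgebra K) (D : hopf_data C).

(** Modelled on B(x, y) = f(xy) for a functional f with f(x1) x2 = f(x) g. Over [cop_data D] the
    same predicate expresses invariance in the other leg. *)
Definition right_inv (g : C) (B : C -> C -> K) :=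
  forall (I J : finType) (t : I -> I -> C) (u : J -> J -> C),
  comatrix t -> comatrix u -> forall i i' j j',
  \sum_a \sum_b B (t i a) (u j b) *: mul D (t a i') (u b j') =
  B (t i i') (u j j') *: g.

Lemma qform_biscalar : biscalar (qform D).
Proof. by split=> x; [apply: qform_sc1 | apply: qform_sc2]; apply: linear_id. Qed.

Variables (g : C) (B : C -> C -> K).
Hypotheses (lB : biscalar B) (invB : right_inv g B).

(** Only the last legs of x and y take part in invariance, and P uses the first ones. Hence bending
    on one side does not destroy what is needed for the other side. *)
Lemma right_inv_conv2 (P : C -> C -> K) : biscalar P -> right_inv g (conv2 P B).
Proof.
move=> lP I J t u tM uM i i' j j'; rewrite conv2_comatrix //.
under [LHS]eq_bigr => a _ do under eq_bigr => b _ do rewrite conv2_comatrix //.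
flat_sums; rewrite [RHS]scaler_suml; pull_sum 2%N; apply: eq_bigr => c _.
rewrite [RHS]scaler_suml; pull_sum 2%N; apply: eq_bigr => d _.
rewrite -[RHS]scalerA -invB //; apply/esym; flat_sums.
by apply: eq_bigr => a _; apply: eq_bigr => b _; rewrite scalerA.
Qed.

Section Mat.
Variables (I J : finType) (t : I -> I -> C) (u : J -> J -> C).
Hypotheses (tM : comatrix t) (uM : comatrix u).

Lemma right_inv_lin (U : lmodType K) (F : C -> U) i i' j j' : linear F ->
  \sum_a \sum_b B (t i a) (u j b) *: F (mul D (t a i') (u b j')) =
  B (t i i') (u j j') *: F g.
Proof.
move=> lF; rewrite -linZ // -invB // lin_sum //; apply: eq_bigr => a _.
by rewrite lin_comb.
Qed.

Lemma right_inv_scal (F : C -> K) i i' j j' : scalar F ->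
  \sum_a \sum_b B (t i a) (u j b) * F (mul D (t a i') (u b j')) =
  B (t i i') (u j j') * F g.
Proof. exact: (@right_inv_lin K^o F). Qed.

(** [qform_bend], read backwards, creates a product xy next to B, which invariance turns into g; the
    factor S(y) it leaves behind is the one multiplied by g. *)
Lemma bend_right i i' j j' :
  \sum_a conv2 B (qform D) (t i a) (u j j') *: t a i' =
  \sum_b conv2 B (qform D) (t i i') (u j b) *: mul D g (antip D (u b j')).
Proof.
have lq := qform_biscalar.
under [LHS]eq_bigr => a _ do rewrite conv2_comatrix //.
flat_sums.
transitivity (\sum_c \sum_d B (t i c) (u j d) *:
    \sum_a qform D (t c a) (u d j') *: t a i').
  pull_sum 1%N; apply: eq_bigr => c _; pull_sum 1%N; apply: eq_bigr => d _.
  by apply/esym; flat_sums; apply: eq_bigr => a _; rewrite scalerA.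
under [LHS]eq_bigr => c _ do under eq_bigr => d _ do rewrite -qform_bend //.
transitivity (\sum_e \sum_a \sum_b qform D (t a i') (u b e) *:
   \sum_c \sum_d B (t i c) (u j d) *: mul D (mul D (t c a) (u d b)) (antip D (u e j'))).
  flat_sums; pull_sum 4%N; apply: eq_bigr => e _; pull_sum 2%N; apply: eq_bigr => a _.
  pull_sum 2%N; apply: eq_bigr => b _; apply/esym; flat_sums.
  by apply: eq_bigr => c _; apply: eq_bigr => d _; rewrite !scalerA mulrC.
apply: eq_bigr => e _; rewrite conv2_comatrix // scaler_suml; apply: eq_bigr => a _.
rewrite scaler_suml; apply: eq_bigr => b _.
by rewrite (right_inv_lin _ _ _ _ (mul_linl D _)) scalerA mulrC.
Qed.

Lemma unbend i i' j j' :
  \sum_a \sum_b B (t i a) (u j b) * phi D (t a i') (u b j') (one D) =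
  \sum_b conv2 B (qform D) (t i i') (u j b) * rform D g (u b j').
Proof.
have lq := qform_biscalar.
under [LHS]eq_bigr => a _ do under eq_bigr => b _ do rewrite -rform_qform //.
transitivity (\sum_e \sum_c \sum_d qform D (t c i') (u d e) *
  (\sum_a \sum_b B (t i a) (u j b) * rform D (mul D (t a c) (u b d)) (u e j'))).
  flat_sums; pull_sum 4%N; apply: eq_bigr => e _; pull_sum 2%N; apply: eq_bigr => c _.
  pull_sum 2%N; apply: eq_bigr => d _; apply/esym; flat_sums.
  apply: eq_bigr => a _; apply: eq_bigr => b _.
  by ring.
apply: eq_bigr => e _; rewrite conv2_comatrix // mulr_suml; apply: eq_bigr => c _.
rewrite mulr_suml; apply: eq_bigr => d _.
rewrite (right_inv_scal (F := fun x => rform D x (u e j'))); first by ring.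
exact: (rform_sc1 _ _ (@linear_id _ _)).
Qed.

(** [unbend] recovers B up to the factor phi(x, y, 1), which psi(x, y, 1) inverts. So B is obtained
    from its bent form by letting functionals act on y. *)
Lemma unbend_inv i i' j j' :
  B (t i i') (u j j') = \sum_a \sum_b \sum_c conv2 B (qform D) (t i a) (u j b) *
    (rform D g (u b c) * psi D (t a i') (u c j') (one D)).
Proof.
have E := phiK D tM uM (one_comatrix D).
transitivity (\sum_a \sum_c (\sum_a0 \sum_b B (t i a0) (u j b) *
     phi D (t a0 a) (u b c) (one D)) * psi D (t a i') (u c j') (one D)).
  transitivity (\sum_a \sum_b ((a == i')%:R * (b == j')%:R) * B (t i a) (u j b)).
    under [RHS]eq_bigr => a _ do under eq_bigr => b _ do rewrite -mulrA.
    by under [RHS]eq_bigr => a _ do rewrite -mulr_sumr sum_deltarK; rewrite sum_deltarK.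
  apply/esym; flat_sums; pull_sum 2%N; apply: eq_bigr => a _; pull_sum 2%N.
  apply: eq_bigr => b _; have := E a i' b j' tt tt; rewrite eqxx mulr1 => <-.
  rewrite mulr_suml; apply: eq_bigr => c _; rewrite mulr_suml; apply: eq_bigr => d _.
  by rewrite big_const card_unit /= addr0; ring.
under [LHS]eq_bigr => a _ do under eq_bigr => c _ do rewrite unbend.
apply: eq_bigr => a _; flat_sums; rewrite exchange_big.
by do 2!apply: eq_bigr => ? _; rewrite mulrA.
Qed.

End Mat.
End RightInvariant.

(** * The action of functionals *)

Section Hits.
Variables (K : fieldType) (C : coalgebra K).
Implicit Types (n m : {linear C -> K^o}).

Definition functional (f : C -> K) (lf : scalar f) : {linear C -> K^o} :=
  HB.pack (f : C -> K^o) (GRing.isLinear.Build K C K^o *:%R f lf).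

Lemma functional_scalar n : scalar (n : C -> K).
Proof. exact: linearP. Qed.

Lemma hit_left_linear n : linear (hit_left n).
Proof. by move=> a x y; rewrite /hit_left /sw2 !linearP. Qed.

Lemma hit_right_linear n : linear (fun x => hit_right x n).
Proof. by move=> a x y; rewrite /hit_right /sw2 !linearP. Qed.

Lemma hit_left_comatrix n (I : finType) (t : I -> I -> C) i j : comatrix t ->
  n -\> t i j = \sum_k (n (t k j) : K) *: t i k.
Proof.
move=> tM; rewrite /hit_left sw2_comatrix // => y a u v.
  by rewrite scalerDr !scalerA mulrC.
by rewrite linearP scalerDl scalerA.
Qed.

Lemma hit_right_comatrix n (I : finType) (t : I -> I -> C) i j : comatrix t ->
  t i j <\- n = \sum_k (n (t i k) : K) *: t k j.
Proof.
move=> tM; rewrite /hit_right sw2_comatrix // => y a u v.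
  by rewrite linearP scalerDl scalerA.
by rewrite scalerDr !scalerA mulrC.
Qed.

Lemma conv_comatrix n m (I : finType) (t : I -> I -> C) i j : comatrix t ->
  conv n m (t i j) = \sum_k (n (t i k) : K) * m (t k j) :> K.
Proof.
move=> tM; rewrite /conv sw2_comatrix // => y; linear_tac.
Qed.

Lemma conv_scalar n m : scalar (conv n m : C -> K).
Proof. by move=> a x y; rewrite /conv /sw2 !linearP. Qed.

Lemma comatrix_extK (f g : C -> K) : scalar f -> scalar g ->
  (forall (I : finType) (t : I -> I -> C) i j, comatrix t -> f (t i j) = g (t i j)) ->
  f =1 g.
Proof. exact: (@comatrix_ext K C K^o). Qed.

Lemma comatrix_ext2 (F G : C -> C -> K) : biscalar F -> biscalar G ->
  (forall (I J : finType) (t : I -> I -> C) (u : J -> J -> C) i i' j j',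
    comatrix t -> comatrix u -> F (t i i') (u j j') = G (t i i') (u j j')) ->
  F =2 G.
Proof.
move=> [F1 F2] [G1 G2] FG x y; move: x.
apply: comatrix_extK => // I t i i' tM; move: y.
by apply: comatrix_extK => // J u j j' uM; apply: FG.
Qed.

Definition convf n m : {linear C -> K^o} := functional (@conv_scalar n m).

Lemma hit_left_conv n m x : n -\> (m -\> x) = convf n m -\> x.
Proof.
move: x; apply: comatrix_ext.
- exact: (linear_comp (hit_left_linear n) (hit_left_linear m)).
- exact: hit_left_linear.
move=> I t i j tM; rewrite !hit_left_comatrix // lin_comb; last exact: hit_left_linear.
under [LHS]eq_bigr => a _ do rewrite hit_left_comatrix //.
flat_sums; pull_sum 1%N; apply: eq_bigr => b _ /=.
rewrite conv_comatrix // scaler_suml; apply: eq_bigr => a _.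
by rewrite scalerA mulrC.
Qed.

Lemma hit_right_conv n m x : x <\- n <\- m = x <\- convf n m.
Proof.
move: x; apply: comatrix_ext.
- exact: (linear_comp (hit_right_linear m) (hit_right_linear n)).
- exact: hit_right_linear.
move=> I t i j tM; rewrite !hit_right_comatrix //.
rewrite (lin_comb _ _ (hit_right_linear m)).
under [LHS]eq_bigr => a _ do rewrite hit_right_comatrix //.
flat_sums; pull_sum 1%N; apply: eq_bigr => b _ /=.
rewrite conv_comatrix // scaler_suml; apply: eq_bigr => a _.
by rewrite scalerA.
Qed.

Lemma hit_comm n m x : n -\> (x <\- m) = (n -\> x) <\- m.
Proof.
move: x; apply: comatrix_ext.
- exact: (linear_comp (hit_left_linear n) (hit_right_linear m)).
- exact: (linear_comp (hit_right_linear m) (hit_left_linear n)).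
move=> I t i j tM; rewrite hit_left_comatrix // hit_right_comatrix //.
rewrite (lin_comb _ _ (hit_right_linear m)) (lin_comb _ _ (hit_left_linear n)).
under [LHS]eq_bigr => a _ do rewrite hit_left_comatrix //.
under [RHS]eq_bigr => a _ do rewrite hit_right_comatrix //.
flat_sums; pull_sum 1%N; apply: eq_bigr => b _ /=; rewrite scaler_sumr.
by apply: eq_bigr => a _; rewrite !scalerA mulrC.
Qed.

Lemma hit_left_counit x : counit C -\> x = x.
Proof. exact: counitr. Qed.

Lemma hit_right_counit x : x <\- counit C = x.
Proof. exact: counitl. Qed.

Lemma eq_hit_left n m x : (forall z, n z = m z) -> n -\> x = m -\> x.
Proof. by move=> nm; apply: eq_tlift => a b; rewrite nm. Qed.

Lemma eq_hit_right n m x : (forall z, n z = m z) -> x <\- n = x <\- m.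
Proof. by move=> nm; apply: eq_tlift => a b; rewrite nm. Qed.

Lemma hit_leftK n m x : (forall c, conv n m c = counit C c) -> n -\> (m -\> x) = x.
Proof.
move=> nm; rewrite hit_left_conv -[RHS]hit_left_counit; exact: eq_hit_left.
Qed.

Lemma hit_rightK n m x : (forall c, conv n m c = counit C c) -> x <\- n <\- m = x.
Proof.
move=> nm; rewrite hit_right_conv -[RHS]hit_right_counit; exact: eq_hit_right.
Qed.

Lemma conv_hit_left n m x : conv n m x = n (m -\> x).
Proof.
move: x; apply: comatrix_extK; first exact: conv_scalar.
  exact: (scalar_comp (functional_scalar n) (hit_left_linear m)).
move=> I t i j tM; rewrite conv_comatrix // hit_left_comatrix //.
by rewrite (scal_comb _ _ (functional_scalar n)); apply: eq_bigr => k _; rewrite mulrC.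
Qed.

Lemma conv_hit_right n m x : conv n m x = m (x <\- n).
Proof.
move: x; apply: comatrix_extK; first exact: conv_scalar.
  exact: (scalar_comp (functional_scalar m) (hit_right_linear n)).
move=> I t i j tM; rewrite conv_comatrix // hit_right_comatrix //.
by rewrite (scal_comb _ _ (functional_scalar m)).
Qed.

Lemma counit_hit_left n x : counit C (n -\> x) = n x.
Proof.
move: x; apply: comatrix_extK; try exact: functional_scalar.
  exact: (scalar_comp (functional_scalar (counit C)) (hit_left_linear n)).
move=> I t i j tM; rewrite hit_left_comatrix // (scal_comb _ _ (functional_scalar _)).
by under [LHS]eq_bigr => a _ do rewrite (tM _ _).2 mulrC; rewrite sum_deltalK.
Qed.

Lemma counit_hit_right n x : counit C (x <\- n) = n x.
Proof.
move: x; apply: comatrix_extK; try exact: functional_scalar.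
  exact: (scalar_comp (functional_scalar (counit C)) (hit_right_linear n)).
move=> I t i j tM; rewrite hit_right_comatrix // (scal_comb _ _ (functional_scalar _)).
by under [LHS]eq_bigr => a _ do rewrite (tM _ _).2 mulrC; rewrite sum_deltarK.
Qed.

Lemma coordf_scalar i : scalar (coord (vbasis {:C}) i : C -> K).
Proof. exact: linearP. Qed.

Definition coordf i : {linear C -> K^o} := functional (coordf_scalar i).

Lemma sw2_basisr (F : C -> C -> K) y : biscalar F ->
  sw2 y (F : C -> C -> K^o) =
  \sum_(i < \dim {:C}) F (vbasis {:C})`_i (y <\- coordf i) :> K.
Proof.
move=> [F1 F2]; move: y; apply: comatrix_extK.
- exact: (scalar_sw2_arg F (@linear_id K C)).
- by apply: scalar_sum => i; apply: (scalar_comp (F2 _) (hit_right_linear _)).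
move=> I t p q tM; rewrite sw2_comatrix //.
under [RHS]eq_bigr => i _ do rewrite hit_right_comatrix // (scal_comb _ _ (F2 _)).
rewrite [RHS]exchange_big; apply: eq_bigr => k _.
by rewrite {1}(basis_expand (t p k)) (scal_comb _ _ (F1 _)).
Qed.

Lemma sw2_basisl (F : C -> C -> K) y : biscalar F ->
  sw2 y (F : C -> C -> K^o) =
  \sum_(i < \dim {:C}) F (coordf i -\> y) (vbasis {:C})`_i :> K.
Proof.
move=> [F1 F2]; move: y; apply: comatrix_extK.
- exact: (scalar_sw2_arg F (@linear_id K C)).
- by apply: scalar_sum => i; apply: (scalar_comp (F1 _) (hit_left_linear _)).
move=> I t p q tM; rewrite sw2_comatrix //.
under [RHS]eq_bigr => i _ do rewrite hit_left_comatrix // (scal_comb _ _ (F1 _)).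
rewrite [RHS]exchange_big; apply: eq_bigr => k _.
by rewrite {1}(basis_expand (t k q)) (scal_comb _ _ (F2 _)).
Qed.

Section Closed.
Variable J : C -> Prop.
Hypotheses (JL : forall n y, J y -> J (n -\> y)).
Hypotheses (JR : forall n y, J y -> J (y <\- n)).

Definition triscalar (F : C -> C -> C -> K) :=
  [/\ forall y z, scalar (fun x => F x y z), forall x z, scalar (fun y => F x y z)
    & forall x y, scalar (F x y)].

(** If J is stable under both actions, a leg of the coproduct of y in J may be treated as lying in
    J: expand the other leg in the basis, and this leg becomes the image of y under the action of a
    coordinate functional. *)
Lemma sw2_zero_r (F : C -> C -> K) y : biscalar F ->
  (forall a b, J b -> F a b = 0) -> J y -> sw2 y (F : C -> C -> K^o) = 0 :> K.
Proof. by move=> lF F0 Jy; rewrite sw2_basisr // big1 // => i _; apply/F0/JR. Qed.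

Lemma sw2_zero_l (F : C -> C -> K) y : biscalar F ->
  (forall a b, J a -> F a b = 0) -> J y -> sw2 y (F : C -> C -> K^o) = 0 :> K.
Proof. by move=> lF F0 Jy; rewrite sw2_basisl // big1 // => i _; apply/F0/JL. Qed.

Lemma biscalar_sw2 (F : C -> C -> C -> K) : triscalar F ->
  biscalar (fun x z => sw2 x (fun a b => F a b z : K^o)).
Proof.
move=> [F1 F2 F3]; split=> [z|x].
  exact: (scalar_sw2_arg (fun a b => F a b z) (@linear_id K C)).
exact: (scalar_sw2 (F := fun z a b => F a b z)).
Qed.

Lemma sw3_zero_m (F : C -> C -> C -> K) y : triscalar F ->
  (forall a b c, J b -> F a b c = 0) -> J y ->
  sw3 y (F : C -> C -> C -> K^o) = 0 :> K.
Proof.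
move=> lF F0 Jy; apply: (sw2_zero_l (biscalar_sw2 lF)) => // x z Jx.
have [F1 F2 F3] := lF; apply: (sw2_zero_r (F := fun a b => F a b z)) => //.
by move=> a b; apply: F0.
Qed.

Lemma sw3_zero_r (F : C -> C -> C -> K) y : triscalar F ->
  (forall a b c, J c -> F a b c = 0) -> J y ->
  sw3 y (F : C -> C -> C -> K^o) = 0 :> K.
Proof.
move=> lF F0 Jy; apply: (sw2_zero_r (biscalar_sw2 lF)) => // x z Jz.
have [F1 F2 F3] := lF; rewrite sw2_basisr // big1 // => i _; exact: F0.
Qed.

End Closed.

Lemma hit_left_cop (n : {linear C -> K^o}) (y : C) :
  @hit_left K (cop_coalg C) n y = y <\- n.
Proof.
apply: sw2_cop => z a u v; first by rewrite scalerDr !scalerA mulrC.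
by rewrite linearP scalerDl scalerA.
Qed.

End Hits.

(** * Nondegeneracy *)

Section Unbend.
Variables (K : fieldType) (C : coalgebra K) (D : hopf_data C).
Variables (g : C) (B : C -> C -> K).
Hypotheses (lB : biscalar B) (invB : right_inv D g B).

(** By [unbend_inv], B(x, y) is a sum of values of the bent form at m -\> y, where m is the
    convolution of z |-> rform(g, z) with z |-> psi(x', z, 1), for x' a leg of x. *)
Lemma unbend_zero y :
  (forall x (m : {linear C -> K^o}), conv2 B (qform D) x (m -\> y) = 0) ->
  forall x, B x y = 0.
Proof.
move=> B0 x; have [B1 B2] := lB; have [q1 q2] := conv2_biscalar B (qform D).
move: x; apply: (@comatrix_extK _ _ (B^~ y) (fun=> 0)) => //.
  by move=> a u v; rewrite mulr0 addr0.
move=> I t i i' tM.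
have l1 : scalar (rform D g) by apply: rform_sc2; apply: linear_id.
have l2 a : scalar (fun z => psi D (t a i') z (one D)).
  by apply: psi_sc2; apply: linear_id.
pose m a := convf (functional l1) (functional (l2 a)).
rewrite (_ : B _ _ = \sum_a conv2 B (qform D) (t i a) (m a -\> y)).
  by rewrite big1 // => a _; apply: B0.
move: y {B0}; apply: comatrix_extK => //.
  apply: scalar_sum => a; apply: (scalar_comp (q2 _)); exact: hit_left_linear.
move=> J u j j' uM; rewrite (unbend_inv lB invB tM uM).
apply: eq_bigr => a _; rewrite hit_left_comatrix // (scal_comb _ _ (q2 _)).
apply: eq_bigr => b _; rewrite /m /= conv_comatrix // mulr_suml.
by apply: eq_bigr => c _ /=; rewrite mulrC.
Qed.

Lemma bend_right_hit (n m : {linear C -> K^o}) x y :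
  (forall z, m z = n (mul D g (antip D z))) ->
  conv2 B (qform D) (n -\> x) y = conv2 B (qform D) x (m -\> y).
Proof.
move=> mn; have [q1 q2] := conv2_biscalar B (qform D).
apply: (@comatrix_ext2 _ _ (fun x y => conv2 B (qform D) (n -\> x) y)
  (fun x y => conv2 B (qform D) x (m -\> y))) => [||I J t u i i' j j' tM uM].
- by split=> z; [apply: (scalar_comp (q1 z)); apply: hit_left_linear | ].
- by split=> z; [ | apply: (scalar_comp (q2 z)); apply: hit_left_linear].
rewrite !hit_left_comatrix // (scal_comb _ _ (q1 _)) (scal_comb _ _ (q2 _)).
have /(congr1 (fun z => n z : K)) := bend_right lB invB tM uM i i' j j'.
rewrite !(scal_comb _ _ (functional_scalar n)) => E.
under [LHS]eq_bigr => a _ do rewrite mulrC; rewrite E.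
by apply: eq_bigr => b _; rewrite mulrC mn.
Qed.

End Unbend.

Section Grouplike.
Variables (K : fieldType) (C : coalgebra K) (D : hopf_data C) (g : C).
Hypothesis gM : comatrix (fun _ _ : unit => g).

Lemma sum_unit (V : nmodType) (F : unit -> V) : \sum_i F i = F tt.
Proof. by rewrite (big_pred1 tt) => [|[]]. Qed.

(** At a group-like element the antipode axiom has a single term, so alpha(g) and beta(g) are
    nonzero and can be cancelled from the antipode laws. *)
Lemma antipode_grouplike_neq0 :
  psi D g (antip D g) g * beta D g * alpha D g = 1.
Proof.
have := antipode_psi D gM tt tt.
by do 4!under [LHS]eq_bigr => ? _ do rewrite ?sum_unit; rewrite !sum_unit.
Qed.

Lemma grouplike_mulVg : mul D (antip D g) g = one D.
Proof.
have := antipode_al D gM tt tt; rewrite !sum_unit => /scalerI; apply.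
apply/eqP => al0; move: antipode_grouplike_neq0; rewrite al0 mulr0 => /esym/eqP.
by rewrite oner_eq0.
Qed.

Let lA : scalar (phi D (antip D g) g).
Proof. exact: phi_lin3. Qed.
Let lA' : scalar (psi D (antip D g) g).
Proof. exact: psi_lin3. Qed.

Definition gphi := functional lA.
Definition gpsi := functional lA'.

Lemma gphi_inverse : conv_inverse gphi gpsi.
Proof.
have gVM := S_comatrix D gM.
split; apply: comatrix_extK; try exact: functional_scalar; try exact: conv_scalar.
  move=> I t i j tM; rewrite conv_comatrix // (tM _ _).2.
  have := phiK D gVM gM tM tt tt tt tt i j; rewrite !eqxx !mul1r => <-.
  by rewrite !sum_unit.
move=> I t i j tM; rewrite conv_comatrix // (tM _ _).2.
have := psiK D gVM gM tM tt tt tt tt i j; rewrite !eqxx !mul1r => <-.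
by rewrite !sum_unit.
Qed.

(** Quasi-associativity for S(g), g and z, with S(g) g = 1, gives S(g) (g (z <\- gphi)) = gphi -\>
    z; then z is replaced by z <\- gpsi. This conjugation is the contribution of the reassociator to
    sigma. *)
Lemma grouplike_mulK z :
  mul D (antip D g) (mul D g z) = (gphi -\> z) <\- gpsi.
Proof.
have [Apsi psiA] := gphi_inverse.
have lN : linear (fun z => mul D (antip D g) (mul D g z)).
  exact: (linear_comp (mul_linr D _) (mul_linr D _)).
rewrite -[in LHS](hit_rightK z psiA) -hit_comm; move: (z <\- gpsi) => {}z.
move: z; apply: comatrix_ext.
- exact: (linear_comp lN (hit_right_linear _)).
- exact: hit_left_linear.
move=> I t i j tM; rewrite hit_left_comatrix // hit_right_comatrix // (lin_comb _ _ lN).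
have := quasi_assoc D (S_comatrix D gM) gM tM tt tt tt tt i j.
rewrite !sum_unit grouplike_mulVg => <-.
by apply: eq_bigr => k _; rewrite mul1c.
Qed.

Lemma grouplike_mul_inj z : mul D g z = 0 -> z = 0.
Proof.
move=> z0; have := grouplike_mulK z; rewrite z0 (lin0 (mul_linr D _)) -hit_comm.
have [Apsi psiA] := gphi_inverse.
move=> /(congr1 (hit_left gpsi)); rewrite hit_leftK // (lin0 (hit_left_linear _)).
by move=> /(congr1 (fun w => hit_right w gphi)); rewrite hit_rightK // (lin0 (hit_right_linear _)).
Qed.

End Grouplike.

(** Used to write an arbitrary functional m as n o T, with n = m o T'. *)
Lemma linear_retract (K : fieldType) (V : vectType K) (T : V -> V) :
  linear T -> (forall z, T z = 0 -> z = 0) ->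
  exists T' : V -> V, linear T' /\ cancel T T'.
Proof.
move=> lT T0.
pose f : {linear V -> V} := HB.pack T (GRing.isLinear.Build K V V *:%R T lT).
exists (fun v => (linfun f)^-1%VF v); split; first by move=> a u v; rewrite linearP.
have k0 : lker (linfun f) == 0%VS.
  rewrite -subv0; apply/subvP => v; rewrite memv_ker lfunE memv0 => /eqP/T0 ->.
  exact: eqxx.
by move=> v; rewrite -[T v](lfunE f) lker0_lfunK.
Qed.

(** The Gram matrix is square, so a trivial radical on one side already makes it invertible, which
    yields both conclusions. *)
Lemma biscalar_nondeg (K : fieldType) (C : coalgebra K) (F : C -> C -> K) :
  biscalar F -> (forall y, (forall x, F x y = 0) -> y = 0) ->
  (forall n : {linear C -> K^o}, exists x, forall y, F x y = n y) /\
  (forall x, (forall y, F x y = 0) -> x = 0).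
Proof.
move=> [F1 F2] F0; pose e := vbasis {:C}; pose d := \dim {:C}.
pose M := (\matrix_(i < d, j < d) F e`_i e`_j)%R.
have FE x y : F x y = \sum_(i < d) \sum_(j < d) coord e i x * coord e j y * M i j.
  rewrite {1}(basis_expand x) (scal_comb _ _ (F1 _)); apply: eq_bigr => i _.
  rewrite {1}(basis_expand y) (scal_comb _ _ (F2 _)) mulr_sumr; apply: eq_bigr => j _.
  by rewrite mxE mulrA.
have ce (c : 'I_d -> K) i : coord e i (\sum_j c j *: e`_j) = c i.
  exact: coord_sum_free (basis_free (vbasisP _)).
have Mu : M \in unitmx.
  rewrite -unitmx_tr -row_free_unit -kermx_eq0; apply/eqP/row_matrixP => k.
  rewrite row0; have : row k (kermx M^T) *m M^T = 0.
    by apply/eqP; rewrite -sub_kermx row_sub.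
  move: (row k _) => c cM.
  (* A row killed by the transposed Gram matrix is the coordinate vector of an element of the
     radical. *)
  have y0 : \sum_j c 0 j *: e`_j = 0.
    apply: F0 => x; rewrite FE big1 // => i _.
    have /rowP/(_ i) := cM; rewrite 2!mxE => /(congr1 (fun z => coord e i x * z)).
    rewrite mulr0 mulr_sumr; apply: etrans; apply: eq_bigr => j _.
    by rewrite ce [M^T _ _]mxE mulrA.
  by apply/rowP => j; rewrite -(ce (c 0)) y0 linear0 mxE.
split=> [n|x x0].
  pose c := (\row_j n e`_j : 'rV[K]_d) *m invmx M.
  have cM : c *m M = \row_j n e`_j by rewrite mulmxKV.
  exists (\sum_i c 0 i *: e`_i) => y; rewrite FE [in RHS](basis_expand y).
  rewrite (scal_comb _ _ (functional_scalar n)) exchange_big; apply: eq_bigr => j _ /=.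
  have /rowP/(_ j) := cM; rewrite 2!mxE => <-; rewrite mulr_sumr.
  by apply: eq_bigr => i _; rewrite ce [_ * coord _ _ _]mulrC; exact/esym/mulrA.
have : (\row_i coord e i x) *m M = 0.
  apply/rowP => j; rewrite !mxE -[RHS](x0 e`_j) FE; apply: eq_bigr => i _.
  rewrite mxE (bigD1 j) //= big1 => [|j' ne].
    by rewrite coord_free ?(basis_free (vbasisP _)) // eqxx mulr1 addr0.
  rewrite coord_free ?(basis_free (vbasisP _)) //.
  have -> : (j == j') = false by apply/negbTE; rewrite eq_sym.
  by rewrite mulr0 mul0r.
move=> /(congr1 (mulmx^~ (invmx M))); rewrite mulmxK // mul0mx => /rowP c0.
by rewrite (basis_expand x) big1 // => i _; have := c0 i; rewrite !mxE => ->; rewrite scale0r.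
Qed.

(** * The nondegenerate form attached to a nonzero cointegral *)

Section Cointegral.
Variables (K : fieldType) (C : coalgebra K) (D : hopf_data C) (g : C) (f : C -> K).
Hypothesis gM : comatrix (fun _ _ : unit => g).
Hypothesis lf : scalar f.
Hypothesis fL : forall (I : finType) (t : I -> I -> C) i j, comatrix t ->
  \sum_k f (t k j) *: t i k = f (t i j) *: one D.
Hypothesis fR : forall (I : finType) (t : I -> I -> C) i j, comatrix t ->
  \sum_k f (t i k) *: t k j = f (t i j) *: g.

Let q := qform D.
Let p : C -> C -> K := qform (cop_data D).
Let B (x y : C) := f (mul D x y).
Let B3 := conv2 (conv2 p B) q.

Let lq : biscalar q. Proof. exact: qform_biscalar. Qed.
Let lp : biscalar p. Proof. exact: (qform_biscalar (cop_data D)). Qed.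
Let lB : biscalar B.
Proof.
by split=> x; apply: (scalar_comp lf); [apply: mul_linl | apply: mul_linr].
Qed.

Let invB : right_inv D g B.
Proof.
move=> I J t u tM uM i i' j j'; rewrite pair_bigA.
exact: (fR (i, j) (i', j') (mul_comatrix D tM uM)).
Qed.

Let invB_cop : right_inv (cop_data D) (one D) B.
Proof.
move=> I J t u /comatrix_cop tM /comatrix_cop uM i i' j j'; rewrite pair_bigA.
exact: (fL (i', j') (i, j) (mul_comatrix D tM uM)).
Qed.

Lemma conv2A (F G E : C -> C -> K) x y : biscalar F -> biscalar G -> biscalar E ->
  conv2 F (conv2 G E) x y = conv2 (conv2 F G) E x y.
Proof.
move=> lF lG lE; have lFG := conv2_biscalar F G; have lGE := conv2_biscalar G E.
apply: comatrix_ext2; try exact: conv2_biscalar.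
move=> I J t u i i' j j' tM uM; rewrite !conv2_comatrix //.
under [LHS]eq_bigr => a _ do under eq_bigr => b _ do rewrite conv2_comatrix //.
under [RHS]eq_bigr => a _ do under eq_bigr => b _ do rewrite conv2_comatrix //.
flat_sums; pull_sum 2%N; apply: eq_bigr => a _; pull_sum 2%N; apply: eq_bigr => b _.
by apply/esym; flat_sums; do 2!apply: eq_bigr => ? _; rewrite mulrA.
Qed.

(** Convolution over the co-opposite is reversed, so q stands on the left there and
    [right_inv_conv2] applies. *)
Let Bq_inv : right_inv (cop_data D) (one D) (conv2 B q).
Proof.
have := @right_inv_conv2 K (cop_coalg C) (cop_data D) (one D) B lB invB_cop q lq.
move=> inv I J t u tM uM i i' j j'.
have := inv I J t u tM uM i i' j j'; rewrite (conv2_cop _ _ lq lB) => <-.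
by do 2!apply: eq_bigr => ? _; rewrite (conv2_cop _ _ lq lB).
Qed.

Let B3E x y : @conv2 K (cop_coalg C) (conv2 B q) p x y = B3 x y.
Proof. by rewrite conv2_cop //; [exact: conv2A | exact: conv2_biscalar]. Qed.

Lemma form_right (n m : {linear C -> K^o}) x y :
  (forall z, m z = n (mul D g (antip D z))) -> B3 (n -\> x) y = B3 x (m -\> y).
Proof.
apply: bend_right_hit; first exact: conv2_biscalar.
exact: right_inv_conv2.
Qed.

Lemma form_left (n m : {linear C -> K^o}) x y :
  (forall z, m z = n (antipV D z)) -> B3 (x <\- n) y = B3 x (y <\- m).
Proof.
move=> mn; rewrite -!B3E -!hit_left_cop.
apply: (@bend_right_hit K (cop_coalg C) (cop_data D) (one D) (@conv2 K C B q)
  (conv2_biscalar B q) Bq_inv n m x y) => z.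
by rewrite mn /= mul1c.
Qed.

Hypothesis f_neq0 : exists z, f z != 0.

Let J (y : C) := forall x, B3 x y = 0.

(** The map z |-> g S(z) is injective, g being cancellable, so every functional m is of the form
    required by [form_right] and its action can be moved to x. *)
Let JL (m : {linear C -> K^o}) y : J y -> J (m -\> y).
Proof.
move=> Jy x.
have [T' [lT' TK]] := @linear_retract K C (fun z => mul D g (antip D z))
  (linear_comp (mul_linr D g) (@S_lin _ _ D)) (fun z (z0 : mul D g (antip D z) = 0) =>
     can_inj (@SK _ _ D) (etrans (grouplike_mul_inj gM z0) (esym (lin0 (@S_lin _ _ D))))).
have ln : scalar (fun z => m (T' z) : K) by exact: (scalar_comp (functional_scalar m)).
rewrite -(form_right (n := functional ln)) => [|z]; first exact: Jy.
by rewrite /= TK.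
Qed.

Let JR (m : {linear C -> K^o}) y : J y -> J (y <\- m).
Proof.
move=> Jy x.
have ln : scalar (fun z => m (antip D z) : K).
  exact: (scalar_comp (functional_scalar m) (@S_lin _ _ D)).
rewrite -(form_left (n := functional ln)) => [|z]; first exact: Jy.
by rewrite /= SbK.
Qed.

(** Both bends are undone in turn, the right one over C and the left one over the co-opposite; the
    actions on y that this introduces stay in J. *)
Let JB y : J y -> forall x, B x y = 0.
Proof.
move=> Jy; apply: (unbend_zero lB invB) => x m.
have {}Jy := JL m Jy; move: (m -\> y) Jy x => {m}y Jy.
apply: (unbend_zero (conv2_biscalar B q : @biscalar K (cop_coalg C) _) Bq_inv) => x m.
by rewrite B3E hit_left_cop; apply: JR.
Qed.
Let rform_g (I : finType) (t : I -> I -> C) i i' y : comatrix t ->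
  \sum_a f (t i a) * rform D (t a i') y = f (t i i') * rform D g y.
Proof.
move=> tM; have lr : scalar (fun x => rform D x y) := rform_sc1 D y (@linear_id K C).
by rewrite -(scal_comb _ _ lr) fR //; apply: (scalZ _ _ lr).
Qed.

(** Since f(z1) z2 = f(z) g, the product f(z) rform(g, y) is a sum of f(z1) alpha(y2) psi(z2, S(y1),
    y3). Under f the scalar alpha is expanded as S(y) y with alpha in between, and [quasi_assocV]
    turns the expression into terms containing f((z S(y1)) y3), which vanish by [JB]. *)
Let rform_zero y : J y -> rform D g y = 0.
Proof.
move=> Jy; have [z0 fz0] := f_neq0.
suff fr : (fun z => f z * rform D g y) =1 (fun=> 0).
  by have /eqP := fr z0; rewrite mulf_eq0 (negPf fz0) => /eqP.
apply: comatrix_extK; first exact: scalar_mull.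
  by move=> a u v; rewrite mulr0 addr0.
move=> I t i i' tM.
pose F a b c := \sum_a' rform D (t i a') b * f (mul D (mul D (t a' i') (antip D a)) c).
have tF : triscalar F.
  split=> u v; apply: scalar_sum => a.
  - apply/scalar_mulr/(scalar_comp lf)/mul_l1/mul_l2/S_l/linear_id.
  - apply/scalar_mull/rform_sc2/linear_id.
  - apply/scalar_mulr/(scalar_comp lf)/mul_l2/linear_id.
transitivity (sw3 y (F : C -> C -> C -> K^o)); last first.
  apply: (sw3_zero_r JR tF) => // a b c Jc; rewrite /F big1 // => a' _.
  by rewrite [f _](JB Jc) mulr0.
move: y {Jy}; apply: comatrix_extK.
- exact/scalar_mulr/rform_sc2/linear_id.
- exact: (scalar_sw3_arg F (@linear_id K C)).
move=> J0 u j' k' uM; have [F1 F2 F3] := tF; rewrite sw3_comatrix // -rform_g //.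
transitivity (\sum_d \sum_e alpha D (u d e) * f (\sum_a \sum_b \sum_c
   psi D (t i a) (antip D (u b d)) (u e c) *: mul D (mul D (t a i') (antip D (u j' b))) (u c k'))).
  under [RHS]eq_bigr => d _ do under eq_bigr => e _ do
    rewrite -(quasi_assocV D tM (S_comatrix D uM) uM).
  transitivity (\sum_a \sum_b \sum_c psi D (t a i') (antip D (u j' b)) (u c k') *
     (\sum_d \sum_e alpha D (u d e) * f (mul D (t i a) (mul D (antip D (u b d)) (u e c))))).
    apply: eq_bigr => a _; rewrite rform_comatrix // mulr_sumr.
    apply: eq_bigr => b _; rewrite mulr_sumr; apply: eq_bigr => c _.
    rewrite (antipode_al_scal D uM b c (F := fun z => f (mul D (t i a) z))).
      by rewrite mulc1; ring.
    exact: (scalar_comp lf (mul_linr D _)).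
  flat_sums; pull_sum 3%N; apply: eq_bigr => d _; pull_sum 3%N; apply: eq_bigr => e _.
  rewrite !(@lin_sum K C K^o f _ _ lf) mulr_sumr; apply: eq_bigr => a _.
  rewrite !(@lin_sum K C K^o f _ _ lf) mulr_sumr; apply: eq_bigr => b _.
  rewrite (scal_comb _ _ lf) mulr_sumr; apply: eq_bigr => c _.
  by ring.
rewrite /F; apply/esym.
under [LHS]eq_bigr => b _ do under eq_bigr => c _ do under eq_bigr => a _ do
  rewrite rform_comatrix //.
flat_sums; pull_sum 3%N; apply: eq_bigr => d _; pull_sum 3%N; apply: eq_bigr => e _.
rewrite !(@lin_sum K C K^o f _ _ lf) mulr_sumr; pull_sum 2%N; apply: eq_bigr => a _.
rewrite !(@lin_sum K C K^o f _ _ lf) mulr_sumr; apply: eq_bigr => b _.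
rewrite (scal_comb _ _ lf) mulr_sumr; apply: eq_bigr => c _.
by ring.
Qed.

(** Inserting psi phi = 1 into f(z) alpha(y) makes psi and alpha combine to rform(z2, y2), which f
    turns into rform(g, y2); this is zero because the leg y2 lies in J. *)
Let al_zero y : J y -> alpha D y = 0.
Proof.
move=> Jy; have [z0 fz0] := f_neq0.
suff fr : (fun z => f z * alpha D y) =1 (fun=> 0).
  by have /eqP := fr z0; rewrite mulf_eq0 (negPf fz0) => /eqP.
apply: comatrix_extK; first exact: scalar_mull.
  by move=> a u v; rewrite mulr0 addr0.
move=> I t i i' tM.
pose F a b c := \sum_a' phi D (t a' i') (antip D a) c * (f (t i a') * rform D g b).
have tF : triscalar F.
  split=> u v; apply: scalar_sum => a.
  - apply/scalar_mull/phi_sc2/S_l/linear_id.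
  - apply/scalar_mulr/scalar_mulr/rform_sc2/linear_id.
  - apply/scalar_mull/phi_sc3/linear_id.
transitivity (sw3 y (F : C -> C -> C -> K^o)); last first.
  apply: (sw3_zero_m JL JR tF) => // a b c Jb; rewrite /F big1 // => a' _.
  by rewrite rform_zero // !mulr0.
move: y {Jy}; apply: comatrix_extK.
- exact/scalar_mulr/al_lin.
- exact: (scalar_sw3_arg F (@linear_id K C)).
move=> J0 u j' k' uM; have [F1 F2 F3] := tF; rewrite sw3_comatrix //.
transitivity (\sum_a \sum_b \sum_c f (t i a) * alpha D (u b c) * (\sum_a' \sum_b' \sum_c'
   psi D (t a a') (antip D (u b' b)) (u c c') * phi D (t a' i') (antip D (u j' b')) (u c' k'))).
  under [RHS]eq_bigr => a _ do under eq_bigr => b _ do under eq_bigr => c _ do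
    rewrite (psiK D tM (S_comatrix D uM) uM).
  rewrite -[LHS](sum_deltarK (fun a => f (t i a) * alpha D (u j' k'))).
  apply: eq_bigr => a _.
  rewrite -[LHS](sum_deltarK (fun b => (a == i')%:R * (f (t i a) * alpha D (u b k')))).
  apply: eq_bigr => b _.
  rewrite -[LHS](sum_deltarK (fun c => (b == j')%:R *
    ((a == i')%:R * (f (t i a) * alpha D (u b c))))).
  by apply: eq_bigr => c _; ring.
rewrite /F; apply/esym.
under [LHS]eq_bigr => b' _ do under eq_bigr => c' _ do under eq_bigr => a' _ do
  rewrite -rform_g //.
under [LHS]eq_bigr => b' _ do under eq_bigr => c' _ do under eq_bigr => a' _ do
  under eq_bigr => a _ do rewrite rform_comatrix //.
flat_sums; pull_sum 3%N; apply: eq_bigr => a _; pull_sum 3%N; apply: eq_bigr => b _.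
pull_sum 3%N; apply: eq_bigr => c _; rewrite mulr_sumr.
pull_sum 2%N; apply: eq_bigr => a' _.
rewrite mulr_sumr; apply: eq_bigr => b' _; rewrite mulr_sumr; apply: eq_bigr => c' _.
by ring.
Qed.

(** The axiom [antipode_psi] writes the counit as a sum in which each term contains alpha of an
    inner leg of y. *)
Let eps_zero y : J y -> counit C y = 0.
Proof.
move=> Jy; pose G a c := sw3 a (fun a1 a2 a3 => beta D a2 * psi D a1 (antip D a3) c : K^o).
pose F a b c := alpha D b * G a c : K.
have tG : forall c, triscalar (fun a1 a2 a3 => beta D a2 * psi D a1 (antip D a3) c).
  move=> c; split=> u v.
  - exact/scalar_mulr/psi_sc1/linear_id.
  - exact/scalar_mull/be_lin.
  - exact/scalar_mulr/psi_sc2/S_l/linear_id.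
have tF : triscalar F.
  split=> u v.
  - apply/scalar_mulr/(scalar_sw3_arg _ (@linear_id K C)).
  - exact/scalar_mull/al_lin.
  - apply/scalar_mulr/(scalar_sw3 (F := fun c a1 a2 a3 => beta D a2 * psi D a1 (antip D a3) c)).
    by move=> a b d; apply/scalar_mulr/psi_sc3/linear_id.
transitivity (sw3 y (F : C -> C -> C -> K^o)); last first.
  by apply: (sw3_zero_m JL JR tF) => // a b c Jb; rewrite /F al_zero // mul0r.
move: y {Jy}; apply: comatrix_extK.
- exact: functional_scalar.
- exact: (scalar_sw3_arg F (@linear_id K C)).
move=> I t i n tM; have [F1 F2 F3] := tF; rewrite sw3_comatrix // (tM _ _).2.
rewrite -(antipode_psi D tM).
have GE l c : G (t i l) c =
    \sum_j \sum_k beta D (t j k) * psi D (t i j) (antip D (t k l)) c.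
  by have [G1 G2 G3] := tG c; rewrite /G sw3_comatrix.
apply/esym; under [LHS]eq_bigr => l _ do under eq_bigr => m _ do rewrite /F GE.
flat_sums; pull_sum 2%N; apply: eq_bigr => j _; pull_sum 2%N.
apply: eq_bigr => k _; apply: eq_bigr => l _; apply: eq_bigr => m _.
by ring.
Qed.

(** Every coordinate of y is the counit of some n -\> y, and J is stable under this action. *)
Let radical_zero y : J y -> y = 0.
Proof.
move=> Jy; rewrite (basis_expand y) big1 // => i _.
by rewrite -[coord _ i y]/(coordf i y) -counit_hit_left eps_zero ?scale0r //; apply: JL.
Qed.

(** With B3(L, y) equal to the counit of y, [form_left] gives B3(L <\- n, y) = n(S^-1(y)) and
    [form_right] gives B3(n -\> L, y) = n(g S(y)). Nondegeneracy turns the first into bijectivity of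
    n |-> L <\- n and the comparison of both into the last claim. *)
Theorem frobenius_generator : exists L : C,
  [/\ forall x, exists n : {linear C -> K^o}, x = L <\- n,
      forall n m : {linear C -> K^o}, L <\- n = L <\- m -> forall z, n z = m z &
      forall n m : {linear C -> K^o},
        (forall z, m z = n (mul D g (antip D (antip D z)))) -> n -\> L = L <\- m].
Proof.
have lB3 : biscalar B3 := conv2_biscalar _ _.
have [ex inj] := biscalar_nondeg lB3 radical_zero; have [B1 B2] := lB3.
have [L LE] := ex (counit C); exists L.
have lSb (n : {linear C -> K^o}) : scalar (fun z => n (antipV D z) : K).
  exact: (scalar_comp (functional_scalar n) (@Sb_lin _ _ D)).
have BL n y : B3 (L <\- n) y = n (antipV D y).
  by rewrite (form_left (m := functional (lSb n))) // LE counit_hit_right.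
split=> [x|n m Lnm z|n m mn].
- have lx : scalar (fun z => B3 x (antip D z)) := scalar_comp (B2 x) (@S_lin _ _ D).
  exists (functional lx); apply/eqP; rewrite -subr_eq0; apply/eqP/inj => y.
  rewrite -[_ - _]addrC -scaleN1r B1 BL /= SbK mulN1r; exact: addNr.
- by rewrite -[z](SK D) -!BL Lnm.
- apply/eqP; rewrite -subr_eq0; apply/eqP/inj => y.
  have lm : scalar (fun z => n (mul D g (antip D z)) : K).
    exact: (scalar_comp (functional_scalar n) (linear_comp (mul_linr D g) (@S_lin _ _ D))).
  rewrite addrC -scaleN1r B1 BL (form_right (m := functional lm)) // LE.
  by rewrite counit_hit_left /= mn SbK mulN1r; apply: addNr.
Qed.

End Cointegral.

(** * Existence of cointegrals *)

Section Existence.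
Variables (K : fieldType) (C : coalgebra K) (D : hopf_data C).

Let r := @regular K C.
Let Y i j := antip D (antip D (r i j)).
Let x_ i (c : C) : K := coord (vbasis {:C}) i c.
Let p : C -> C -> K := qform (cop_data D).

Let rM : comatrix r. Proof. exact: regular_comatrix. Qed.
Let YM : comatrix Y. Proof. exact: (S_comatrix D (S_comatrix D rM)). Qed.
Let x_lin i : scalar (x_ i). Proof. exact: coordf_scalar. Qed.
Let p1 y : scalar (p^~ y). Proof. exact: (qform_biscalar (cop_data D)).1. Qed.
Let p2 x : scalar (p x). Proof. exact: (qform_biscalar (cop_data D)).2. Qed.

(* With [e_i] the basis and [e^i] its dual, the [m]-th coordinate of the sum over [i]
   of [e^i (k (x, y1)) y2] for [y = e_i], where
   [k (x, y) = p (x1, S^2 y1) beta (x2 (S^2 y2)) x3 (S^2 y3)]. *)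
Definition trace_form m (x : C) : K := \sum_i \sum_j \sum_k
  (sw3 x (fun x1 x2 x3 =>
    p x1 (Y i j) * beta D (mul D x2 (Y j k)) * x_ i (mul D x3 (Y k m)) : K^o) : K).

Lemma trace_form_scalar m : scalar (trace_form m).
Proof. by do 3!apply: scalar_sum => ?; apply: scalar_sw3_arg. Qed.

Section Mat.
Variables (I : finType) (t : I -> I -> C).
Hypothesis tM : comatrix t.

Let z (a b : I * 'I_(\dim {:C})) := mul D (t a.1 b.1) (Y a.2 b.2).
Let zM : comatrix z. Proof. exact: mul_comatrix. Qed.

Lemma trace_form_comatrix m a s : trace_form m (t a s) =
  \sum_i \sum_b \sum_c p (t a b.1) (Y i b.2) * beta D (z b c) * x_ i (z c (s, m)).
Proof.
apply: eq_bigr => i _; rewrite -[RHS](pair_bigA _ (fun b j => \sum_c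
   p (t a b) (Y i j) * beta D (z (b, j) c) * x_ i (z c (s, m)))) /= [RHS]exchange_big /=.
apply: eq_bigr => j _.
under [RHS]eq_bigr => b _ do rewrite -(pair_bigA _ (fun c k =>
   p (t a b) (Y i j) * beta D (z (b, j) (c, k)) * x_ i (z (c, k) (s, m)))) /=.
apply/esym; pull_sum 2%N; apply: eq_bigr => k _; rewrite sw3_comatrix // => u v.
- apply/scalar_mull/scalar_mull/p1.
- apply/scalar_mull/scalar_mulr/be_sc/mul_l1/linear_id.
- apply/scalar_mulr/(scalar_comp (x_lin i))/mul_l1/linear_id.
Qed.

(** [qform_bend] for the co-opposite, at y replaced by S^2(y), leaves a factor S^-1(S^2(y)) = S(y).
    The trace carries it over to the output x S^2(y), where it becomes the antipode of a leg of that
    product; then the beta law for the product comatrix [z] yields the unit. *)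
Lemma trace_form_cointegral m a s :
  \sum_k trace_form m (t k s) *: t a k = trace_form m (t a s) *: one D.
Proof.
have L i b j : \sum_k p (t k b) (Y i j) *: t a k = \sum_c \sum_d \sum_e
    p (t a c) (Y e d) *: mul D (mul D (t c b) (Y d j)) (antip D (r i e)).
  rewrite -(qform_bend (cop_data D) (cop_comatrix tM) (cop_comatrix YM)).
  by do 3!apply: eq_bigr => ? _; rewrite /= SK.
(* This is the cyclicity of the trace: summing over the trace index [i] replaces the coefficient of
   the basis vector e_i by a slice of the output b. *)
have E e b : \sum_i x_ i b *: antip D (r i e) = antip D (slice e b).
  by rewrite slice_regular (lin_comb _ _ (@S_lin _ _ D)).
under [LHS]eq_bigr => k _ do rewrite trace_form_comatrix.
transitivity (\sum_e \sum_f p (t a f.1) (Y e f.2) *: \sum_b \sum_c beta D (z b c) *: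
    mul D (z f b) (antip D (slice e (z c (s, m))))).
  flat_sums; pull_sum 1%N.
  transitivity (\sum_i \sum_b \sum_c beta D (z b c) *: (x_ i (z c (s, m)) *:
      \sum_k p (t k b.1) (Y i b.2) *: t a k)).
    apply: eq_bigr => i _; pull_sum 1%N; apply: eq_bigr => b _; pull_sum 1%N.
    apply: eq_bigr => c _; apply/esym; flat_sums; apply: eq_bigr => k _.
    by rewrite !scalerA; congr (_ *: _); ring.
  under [LHS]eq_bigr => i _ do under eq_bigr => b _ do under eq_bigr => c _ do rewrite L.
  flat_sums; pull_sum 5%N; apply: eq_bigr => e _.
  rewrite -[RHS](pair_bigA _ (fun f g => p (t a f) (Y e g) *:
    \sum_b \sum_c beta D (z b c) *: mul D (z (f, g) b) (antip D (slice e (z c (s, m)))))) /=.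
  pull_sum 3%N; apply: eq_bigr => f _; pull_sum 3%N; apply: eq_bigr => g _.
  apply/esym; flat_sums; apply/esym; pull_sum 1%N; apply: eq_bigr => b _.
  pull_sum 1%N; apply: eq_bigr => c _.
  rewrite -E (lin_comb _ _ (mul_linr D _)); apply/esym; flat_sums.
  by apply: eq_bigr => i _; rewrite !scalerA; congr (_ *: _); ring.
rewrite trace_form_comatrix scaler_suml; apply: eq_bigr => e _.
rewrite scaler_suml; apply: eq_bigr => f _.
transitivity (p (t a f.1) (Y e f.2) *: \sum_g x_ e (z g (s, m)) *:
   \sum_b \sum_c beta D (z b c) *: mul D (z f b) (antip D (z c g))).
  congr (_ *: _); apply/esym; flat_sums; pull_sum 1%N; apply: eq_bigr => b _.
  pull_sum 1%N; apply: eq_bigr => c _; rewrite slice_comatrix //.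
  rewrite (lin_comb _ _ (@S_lin _ _ D)) (lin_comb _ _ (mul_linr D _)) scaler_sumr.
  by apply: eq_bigr => g _; rewrite !scalerA mulrC.
rewrite scaler_sumr scaler_suml; apply: eq_bigr => g _.
rewrite antipode_be // !scalerA; congr (_ *: _); ring.

Qed.

End Mat.

Lemma S_one : antip D (one D) = one D.
Proof. by rewrite -[LHS](mulc1 D) grouplike_mulVg //; apply: one_comatrix. Qed.

Lemma Sb_one : antipV D (one D) = one D.
Proof. by rewrite -{1}S_one SK. Qed.

(** As 1 is group-like, its j-th slice is its j-th coordinate times 1. *)
Let slice_one (F : C -> K) j : scalar F ->
  \sum_i x_ i (one D) * F (r i j) = x_ j (one D) * F (one D).
Proof.
move=> lF; rewrite -(scal_comb _ _ lF) -slice_regular.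
by rewrite (slice_comatrix j tt tt (one_comatrix D)) sum_unit scalZ.
Qed.

(* If every [trace_form m] vanished, substituting [x = S(y)] would make the trace
   collapse to a nonzero multiple of the unit. *)
Lemma exists_cointegral : exists m z, trace_form m z != 0.
Proof.
pose s i j := antip D (r j i); have sM : comatrix s by exact: S_comatrix.
have al_be : psi D (one D) (antip D (one D)) (one D) * beta D (one D) * alpha D (one D) = 1.
  exact: antipode_grouplike_neq0 (one_comatrix D).
have e1 : counit C (one D) = 1 := (one_comatrix D tt tt).2.
have E n : \sum_m \sum_m' beta D (s m' m) * trace_form m (s n m') =
    x_ n (one D) * (p (one D) (one D) * beta D (one D) * beta D (one D)).
  pose o := one D.
  have so F i : scalar F -> \sum_k x_ k o * F (s i k) = x_ i o * F o.
    move=> lF; rewrite (slice_one i (F := fun c => F (antip D c))) ?S_one //.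
    exact: (scalar_comp lF (@S_lin _ _ D)).
  have Yo F j : scalar F -> \sum_i x_ i o * F (Y i j) = x_ j o * F o.
    move=> lF; rewrite (slice_one j (F := fun c => F (antip D (antip D c)))) ?S_one //.
    exact: (scalar_comp lF (linear_comp (@S_lin _ _ D) (@S_lin _ _ D))).
  (* Since Y(k, m) = S(s(m, k)), the sum weighted with beta(s(m', m)) forms s S(s) with beta in
     between, so the argument of the coordinate [x_ i] becomes a multiple of 1. The remaining
     contractions with coordinates of 1 are evaluated by [Yo] and [so]. *)
  transitivity (\sum_b \sum_c (\sum_i x_ i o * p (s n b.1) (Y i b.2)) *
      (beta D (mul D (s b.1 c.1) (Y b.2 c.2)) * beta D (s c.1 c.2))).
    under [LHS]eq_bigr => m _ do under eq_bigr => m' _ do rewrite trace_form_comatrix //.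
    flat_sums; pull_sum 3%N; apply: eq_bigr => b _; pull_sum 3%N; apply: eq_bigr => c _.
    rewrite mulr_suml; pull_sum 2%N; apply: eq_bigr => i _.
    transitivity (p (s n b.1) (Y i b.2) * beta D (mul D (s b.1 c.1) (Y b.2 c.2)) *
        (\sum_m' \sum_m beta D (s m' m) * x_ i (mul D (s c.1 m') (antip D (s m c.2))))).
      rewrite exchange_big mulr_sumr; apply: eq_bigr => m' _.
      by rewrite mulr_sumr; apply: eq_bigr => m _; rewrite /=; ring.
    by rewrite (antipode_be_scal D sM _ _ (x_lin i)); ring.
  under [LHS]eq_bigr => b _ do rewrite (Yo _ _ (p2 _)).
  rewrite -(pair_bigA _ (fun r1 j => \sum_c x_ j o * p (s n r1) o *
     (beta D (mul D (s r1 c.1) (Y j c.2)) * beta D (s c.1 c.2)))) /=.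
  transitivity (\sum_r1 x_ r1 o * p (s n r1) o * (beta D o * beta D o)); last first.
    rewrite -mulr_suml (so (p^~ o)) //; by ring.
  apply: eq_bigr => r1 _; rewrite exchange_big /=.
  transitivity (p (s n r1) o * \sum_c beta D (s c.1 c.2) *
      \sum_j x_ j o * beta D (mul D (s r1 c.1) (Y j c.2))).
    apply/esym; flat_sums; apply: eq_bigr => c _; apply: eq_bigr => j _; ring.
  rewrite -(pair_bigA _ (fun r2 k => beta D (s r2 k) *
      \sum_j x_ j o * beta D (mul D (s r1 r2) (Y j k)))) /=.
  transitivity (p (s n r1) o * \sum_r2 beta D (s r1 r2) *
      \sum_k x_ k o * beta D (s r2 k)).
    congr (_ * _); apply: eq_bigr => r2 _; rewrite mulr_sumr; apply: eq_bigr => k _.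
    rewrite (Yo (fun c => beta D (mul D (s r1 r2) c))) ?mulc1; first by ring.
    exact: (scalar_comp (@be_lin _ _ D) (mul_linr D _)).
  under [X in _ * X]eq_bigr => r2 _ do
    rewrite (so _ _ (@be_lin _ _ D)) mulrC -mulrA [beta D o * _]mulrC mulrA.
  by rewrite -mulr_suml (so _ _ (@be_lin _ _ D)); ring.
have al0 : alpha D (one D) != 0.
  by apply/eqP => a0; move: al_be; rewrite a0 mulr0 => /esym/eqP; rewrite oner_eq0.
have be0 : beta D (one D) != 0.
  by apply/eqP => a0; move: al_be; rewrite a0 mulr0 mul0r => /esym/eqP; rewrite oner_eq0.
have p0 : p (one D) (one D) = alpha D (one D).
  rewrite /p (qform_comatrix (cop_data D) (one D) tt tt (cop_comatrix (one_comatrix D))).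
  by rewrite !sum_unit /= Sb_one psi_one e1 !mulr1.
have [/existsP[m /existsP[m' /existsP [n mn]]]|no] :=
    boolP [exists m, [exists m', [exists n, trace_form m (s n m') != 0]]].
  by exists m, (s n m').
(* If all these values of the trace forms were zero, [E] would kill every coordinate of 1, as p(1,1)
   = alpha(1) and beta(1) are nonzero; but the counit of 1 is 1. *)
have z0 n : x_ n (one D) = 0.
  have := E n; rewrite big1 => [/esym/eqP|m _].
    by rewrite !mulf_eq0 p0 (negPf al0) (negPf be0) !orbF => /eqP.
  rewrite big1 // => m' _; move: no; rewrite negb_exists => /forallP/(_ m).
  rewrite negb_exists => /forallP/(_ m'); rewrite negb_exists => /forallP/(_ n).
  by rewrite negbK => /eqP->; rewrite mulr0.
have : one D = 0 by rewrite (basis_expand (one D)) big1 // => i _; rewrite [coord _ _ _]z0 scale0r.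
by move=> o0; move/eqP: e1; rewrite o0 linear0 eq_sym oner_eq0.
Qed.

End Existence.

Ltac sw2_step := rewrite [LHS]sw2_comatrix //;
  try by (move=> ?; rewrite /sw3 /sw2 /cqmul; linear_tac).

(** * From coquasi Hopf algebras to coquasi Hopf data *)

Section Morphisms.
Variables (K : fieldType) (C D : coalgebra K).

Lemma morphism_comatrix (f : {linear C -> D}) (I : finType) (t : I -> I -> C) :
  coalg_morphism f -> comatrix t -> comatrix (fun i j => f (t i j)).
Proof.
move=> [fM fe] tM i j; split; last by rewrite fe (tM i j).2.
rewrite fM sw2_comatrix // => y.
  exact: (linear_comp (@tens_linearl _ _ _ (f y)) (linearP f)).
exact: (linear_comp (@tens_linearr _ _ _ (f y)) (linearP f)).
Qed.

Lemma tens_comatrix (I J : finType) (t : I -> I -> C) (u : J -> J -> D) :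
  comatrix t -> comatrix u ->
  @comatrix K (tensor_coalg C D) _ (fun p q : I * J => t p.1 q.1 \ox u p.2 q.2).
Proof.
move=> tM uM p q; split.
  rewrite [LHS]tensor_comulE sw2_comatrix //.
  - rewrite -[RHS](pair_bigA _ (fun a b => (t p.1 a \ox u p.2 b) \ox (t a q.1 \ox u b q.2))) /=.
    apply: eq_bigr => a _; rewrite sw2_comatrix // => y; linear_tac.
  - by move=> y; rewrite /sw2; linear_tac.
  - by move=> y; rewrite /sw2; linear_tac.
rewrite [LHS]tensor_counitE (tM _ _).2 (uM _ _).2 -natrM mulnb.
by case: p q => a b [c d]; rewrite xpair_eqE.
Qed.

Lemma base_comatrix : @comatrix K (base_coalg K) unit (fun _ _ => 1).
Proof.
move=> [] []; split=> //; by rewrite sum_unit; apply: scale1r.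
Qed.

End Morphisms.

Lemma eq_coord (K : fieldType) (V : vectType K) (x y : V) :
  (forall f : V -> K, scalar f -> f x = f y) -> x = y.
Proof.
move=> fxy; rewrite (coord_vbasis (memvf x)) (coord_vbasis (memvf y)).
apply: eq_bigr => i _; congr (_ *: _); apply: (fxy (coord (vbasis {:V}) i)).
exact: linearP.
Qed.

Section HopfData.
Variables (K : fieldType) (H : coquasi_hopf K) (Sbar : H -> H).
Hypotheses (SK : cancel (antipode H) Sbar) (SbarK : cancel Sbar (antipode H)).

Let phi (c d e : H) : K := reassoc H (c \ox d \ox e).
Let psi (c d e : H) : K := reassocV H (c \ox d \ox e).
Let antip (c : H) : H := antipode H c.

Let phi1 y z : scalar (fun x => phi x y z).
Proof. by move=> a u v; rewrite /phi !tens_linearl linearP. Qed.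
Let phi2 x z : scalar (fun y => phi x y z).
Proof. by move=> a u v; rewrite /phi tens_linearr tens_linearl linearP. Qed.
Let phi3 x y : scalar (fun z => phi x y z).
Proof. by move=> a u v; rewrite /phi tens_linearr linearP. Qed.
Let psi1 y z : scalar (fun x => psi x y z).
Proof. by move=> a u v; rewrite /psi !tens_linearl linearP. Qed.
Let psi2 x z : scalar (fun y => psi x y z).
Proof. by move=> a u v; rewrite /psi tens_linearr tens_linearl linearP. Qed.
Let psi3 x y : scalar (fun z => psi x y z).
Proof. by move=> a u v; rewrite /psi tens_linearr linearP. Qed.
Let mul1 y : linear (fun x : H => x \cm y).
Proof. by move=> a u v; rewrite /cqmul tens_linearl linearP. Qed.
Let mul2 x : linear (fun y : H => x \cm y).
Proof. by move=> a u v; rewrite /cqmul tens_linearr linearP. Qed.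
Let S_linear : linear antip.
Proof. exact: linearP. Qed.
Let Sbar_linear : linear Sbar.
Proof.
move=> a u v; apply: (can_inj SK); rewrite SbarK.
rewrite -[in LHS](SbarK u) -[in LHS](SbarK v); exact/esym/S_linear.
Qed.

Let mulM (I J : finType) (t : I -> I -> H) (u : J -> J -> H) :
  comatrix t -> comatrix u ->
  comatrix (fun p q : I * J => t p.1 q.1 \cm u p.2 q.2).
Proof.
have [[mM _] _ _ _ _] := cqb_axioms H => tM uM.
exact: (morphism_comatrix mM (tens_comatrix tM uM)).
Qed.

Let oneM : comatrix (fun _ _ : unit => cqone : H).
Proof.
have [[_ uM] _ _ _ _] := cqb_axioms H.
exact: (morphism_comatrix uM (@base_comatrix K)).
Qed.

Let SM (I : finType) (t : I -> I -> H) :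
  comatrix t -> comatrix (fun i j => antip (t j i)).
Proof.
have [aM _ _ _ _] := cqh_axioms H => tM.
exact: (morphism_comatrix aM (cop_comatrix tM)).
Qed.

Let SbarM (I : finType) (t : I -> I -> H) :
  comatrix t -> comatrix (fun i j => Sbar (t j i)).
Proof.
have [[aM ae] _ _ _ _] := cqh_axioms H.
have SbE (c : H) : comul H (Sbar c) = sw2 c (fun c1 c2 => Sbar c2 \ox Sbar c1).
  rewrite -[c in RHS]SbarK /sw2 aM; move: (Sbar c) => d.
  rewrite linear_tlift [RHS]sw2_cop.
  - rewrite {1}[comul H d]tensor_span; apply: eq_tlift => a b.
    symmetry; apply: etrans; first apply: (@tlift_tens K H H _ _ (antip b) (antip a)).
    + by move=> y k u v; rewrite Sbar_linear tens_linearr.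
    + by move=> y k u v; rewrite Sbar_linear tens_linearl.
    + by rewrite /antip !SK.
  - by move=> y; linear_tac.
  - by move=> y; linear_tac.
move=> tM i j; split; last first.
  by rewrite -[LHS]ae [antipode H _]SbarK (tM _ _).2 eq_sym.
rewrite SbE sw2_comatrix // => y k u v; rewrite Sbar_linear.
  by rewrite tens_linearr.
by rewrite tens_linearl.
Qed.

Let convK3 (P Q : {linear tensor3_coalg H -> K^o}) :
  (forall c, conv P Q c = counit _ c) ->
  inverse3 (fun c d e : H => P (c \ox d \ox e) : K) (fun c d e => Q (c \ox d \ox e)).
Proof.
move=> PQ I J L t u v tM uM vM i i' j j' k k'.
have M := tens_comatrix (tens_comatrix tM uM) vM.
transitivity (conv P Q (t i i' \ox u j j' \ox v k k') : K).
  rewrite (conv_comatrix P Q (i, j, k) (i', j', k') M) !pair_bigA.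
  by apply: eq_bigr => -[[a b] c] _.
by rewrite PQ [LHS]tensor_counitE [X in X * _]tensor_counitE (tM _ _).2 (uM _ _).2 (vM _ _).2.
Qed.

Let phiK : inverse3 phi psi.
Proof. by have [_ [e _] _ _ _] := cqb_axioms H; apply: convK3. Qed.

Let psiK : inverse3 psi phi.
Proof. by have [_ [_ e] _ _ _] := cqb_axioms H; apply: convK3. Qed.

Let phi_one c d : phi c cqone d = counit H c * counit H d.
Proof. by have [_ _ _ _ [_ e]] := cqb_axioms H; apply: e. Qed.

(** Evaluate phi psi = 1 at (c, 1, d), where phi is already trivial. *)
Let psi_one c d : psi c cqone d = counit H c * counit H d.
Proof.
move: c d; apply: comatrix_ext2.
- by split=> y; [apply: psi1 | apply: psi3].
- by split=> y; [apply/scalar_mull/functional_scalar | apply/scalar_mulr/functional_scalar].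
move=> I J t u i i' j j' tM uM; have := phiK tM oneM uM i i' tt tt j j'.
rewrite eqxx mulr1 (tM _ _).2 (uM _ _).2 => <-.
under [RHS]eq_bigr => a _ do rewrite sum_unit.
under [RHS]eq_bigr => a _ do under eq_bigr => b _ do
  rewrite phi_one (tM _ _).2 (uM _ _).2 -mulrA.
under [RHS]eq_bigr => a _ do rewrite -mulr_sumr sum_deltalK.
by rewrite sum_deltalK.
Qed.

Let quasi_assoc (I J L : finType) (t : I -> I -> H) (u : J -> J -> H)
    (v : L -> L -> H) : comatrix t -> comatrix u -> comatrix v ->
    forall i i' j j' k k',
  \sum_a \sum_b \sum_c phi (t a i') (u b j') (v c k') *:
    (t i a \cm u j b \cm v k c) =
  \sum_a \sum_b \sum_c phi (t i a) (u j b) (v k c) *: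
    (t a i' \cm (u b j' \cm v c k')).
Proof.
move=> tM uM vM i i' j j' k k'.
have [_ _ _ /(_ (t i i') (u j j') (v k k')) e _] := cqb_axioms H.
transitivity (sw2 (t i i') (fun c1 c2 => sw2 (u j j') (fun d1 d2 =>
    sw2 (v k k') (fun e1 e2 => phi c2 d2 e2 *: (c1 \cm d1 \cm e1))))).
  apply/esym; sw2_step; apply: eq_bigr => a _; sw2_step; apply: eq_bigr => b _; sw2_step.
rewrite [LHS]e.
sw2_step; apply: eq_bigr => a _; sw2_step; apply: eq_bigr => b _; sw2_step.
Qed.

(** Tested against a functional n, quasi-associativity is a matrix identity X Phi = Phi X';
    multiplying by the inverse of Phi on both sides gives X' Psi = Psi X. *)
Let quasi_assocV (I J L : finType) (t : I -> I -> H) (u : J -> J -> H)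
    (v : L -> L -> H) : comatrix t -> comatrix u -> comatrix v ->
    forall i i' j j' k k',
  \sum_a \sum_b \sum_c psi (t a i') (u b j') (v c k') *:
    (t i a \cm (u j b \cm v k c)) =
  \sum_a \sum_b \sum_c psi (t i a) (u j b) (v k c) *:
    (t a i' \cm u b j' \cm v c k').
Proof.
move=> tM uM vM i i' j j' k k'; apply: eq_coord => n ln.
pose mx3 (F : H -> H -> H -> K) := mxof (fun a b : I * J * L =>
  F (t a.1.1 b.1.1) (u a.1.2 b.1.2) (v a.2 b.2)).
have mx3M (F G : H -> H -> H -> K) : mx3 F *m mx3 G = mxof (fun a b =>
    \sum_x \sum_y \sum_z F (t a.1.1 x) (u a.1.2 y) (v a.2 z) *
      G (t x b.1.1) (u y b.1.2) (v z b.2)).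
  by rewrite mxof_mul; apply: eq_mxof => a b; rewrite !pair_bigA; apply: eq_bigr => -[[]].
have mx3K (F G : H -> H -> H -> K) : inverse3 F G -> mx3 F *m mx3 G = 1%:M.
  move=> FG; rewrite mx3M -mxof1; apply: eq_mxof => -[[a b] c] [[a' b'] c'].
  by rewrite FG // !xpair_eqE -!natrM !mulnb.
pose X := mx3 (fun c d e => n (c \cm d \cm e)).
pose X' := mx3 (fun c d e => n (c \cm (d \cm e))).
have XE : X *m mx3 phi = mx3 phi *m X'.
  rewrite !mx3M; apply: eq_mxof => a b.
  have /(congr1 n) := quasi_assoc tM uM vM a.1.1 b.1.1 a.1.2 b.1.2 a.2 b.2.
  rewrite ![n (\sum_a _)](@lin_sum K H K^o n _ _ ln) => E; apply: etrans (etrans E _).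
    apply: eq_bigr => x _; rewrite (@lin_sum K H K^o n _ _ ln).
    by apply: eq_bigr => y _; rewrite (scal_comb _ _ ln); apply: eq_bigr => z _; rewrite mulrC.
  apply: eq_bigr => x _; rewrite (@lin_sum K H K^o n _ _ ln).
  by apply: eq_bigr => y _; rewrite (scal_comb _ _ ln).
have : X' *m mx3 psi = mx3 psi *m X.
  rewrite -[X']mul1mx -(mx3K _ _ psiK) -(mulmxA _ (mx3 phi)) -XE -!mulmxA.
  by rewrite (mx3K _ _ phiK) mulmx1.
rewrite !mx3M => /mxof_inj /(_ (i, j, k) (i', j', k')) /= E.
rewrite ![n (\sum_a _)](@lin_sum K H K^o n _ _ ln); apply: etrans (etrans E _).
  apply: eq_bigr => x _; rewrite (@lin_sum K H K^o n _ _ ln).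
  by apply: eq_bigr => y _; rewrite (scal_comb _ _ ln); apply: eq_bigr => z _; rewrite mulrC.
apply: eq_bigr => x _; rewrite (@lin_sum K H K^o n _ _ ln).
by apply: eq_bigr => y _; rewrite (scal_comb _ _ ln).
Qed.

Let pentagon_comatrix (I J L M : finType) (t : I -> I -> H) (u : J -> J -> H)
    (v : L -> L -> H) (w : M -> M -> H) : comatrix t -> comatrix u ->
    comatrix v -> comatrix w -> forall i i' j j' k k' l l',
  \sum_a \sum_b \sum_c \sum_d phi (t i a \cm u j b) (v k c) (w l d) *
    phi (t a i') (u b j') (v c k' \cm w d l') =
  \sum_a \sum_b2 \sum_b1 \sum_c2 \sum_c1 \sum_d
    phi (t i a) (u j b1) (v k c1) * phi (t a i') (u b1 b2 \cm v c1 c2) (w l d) *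
    phi (u b2 j') (v c2 k') (w d l').
Proof.
move=> tM uM vM wM i i' j j' k k' l l'.
have [_ _ _ _ [/(_ (t i i') (u j j') (v k k') (w l l')) e _]] := cqb_axioms H.
transitivity (sw2 (t i i') (fun c1 c2 => sw2 (u j j') (fun d1 d2 =>
    sw2 (v k k') (fun e1 e2 => sw2 (w l l') (fun f1 f2 =>
     phi (c1 \cm d1) e1 f1 * phi c2 d2 (e2 \cm f2) : K^o)))) : K).
  apply/esym; do 3!(sw2_step; apply: eq_bigr => ? _); sw2_step.
rewrite [LHS]e.
sw2_step; apply: eq_bigr => a _; rewrite /sw3.
do 4!(sw2_step; apply: eq_bigr => ? _).
sw2_step.
Qed.

Let pentagon (I J L M : finType) (t : I -> I -> H) (u : J -> J -> H)
    (v : L -> L -> H) (w : M -> M -> H) :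
  comatrix t -> comatrix u -> comatrix v -> comatrix w ->
  mx4 t u v w (fun c d e f => phi (c \cm d) e f) *m
  mx4 t u v w (fun c d e f => phi c d (e \cm f)) =
  mx4 t u v w (fun c d e f => phi c d e * counit H f) *m
  mx4 t u v w (fun c d e f => phi c (d \cm e) f) *m
  mx4 t u v w (fun c d e f => counit H c * phi d e f).
Proof.
move=> tM uM vM wM; rewrite !mxof_mul.
apply: eq_mxof => -[[[i j] k] l] [[[i' j'] k'] l'].
rewrite sum4 pentagon_comatrix // sum4 /=; apply/esym.
under [LHS]eq_bigr => a _ do under eq_bigr => b _ do under eq_bigr => c _ do
  under eq_bigr => d _ do rewrite sum4 /=.
flat_sums; pull_sum 4%N; apply: eq_bigr => a _; pull_sum 1%N; apply: eq_bigr => b2 _.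
pull_sum 3%N; apply: eq_bigr => b1 _; pull_sum 1%N; apply: eq_bigr => c2 _.
pull_sum 2%N; apply: eq_bigr => c1 _; pull_sum 1%N; apply: eq_bigr => d _.
transitivity (\sum_x (x == i')%:R * \sum_y (l == y)%:R *
  (phi (t i a) (u j b1) (v k c1) * phi (t a x) (u b1 b2 \cm v c1 c2) (w y d) *
    phi (u b2 j') (v c2 k') (w d l'))).
  apply: eq_bigr => x _; rewrite mulr_sumr; apply: eq_bigr => y _.
  by rewrite (tM _ _).2 (wM _ _).2; ring.
by rewrite sum_deltarK sum_deltalK.
Qed.

(** The two sides are the inverse matrices of the two sides of [pentagon]. *)
Let pentagonV (I J L M : finType) (t : I -> I -> H) (u : J -> J -> H)
    (v : L -> L -> H) (w : M -> M -> H) :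
  comatrix t -> comatrix u -> comatrix v -> comatrix w ->
  mx4 t u v w (fun c d e f => psi c d (e \cm f)) *m
  mx4 t u v w (fun c d e f => psi (c \cm d) e f) =
  mx4 t u v w (fun c d e f => counit H c * psi d e f) *m
  mx4 t u v w (fun c d e f => psi c (d \cm e) f) *m
  mx4 t u v w (fun c d e f => psi c d e * counit H f).
Proof.
move=> tM uM vM wM; have P := pentagon tM uM vM wM; have mM := @mulM.
set M12 := mx4 _ _ _ _ (fun c d e f => psi (c \cm d) e f).
set M34 := mx4 _ _ _ _ (fun c d e f => psi c d (e \cm f)).
set R := RHS; rewrite -[LHS]mulmx1.
have <- : mx4 t u v w (fun c d e f => phi (c \cm d) e f) *m
    mx4 t u v w (fun c d e f => phi c d (e \cm f)) *m R = 1%:M.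
  rewrite P /R -!mulmxA (mulmxA (mx4 _ _ _ _ (fun c d e f => _ * phi d e f))).
  rewrite (mx4_invl phiK tM uM vM wM) mul1mx.
  rewrite (mulmxA (mx4 _ _ _ _ (fun c d e f => phi c (d \cm e) f))).
  by rewrite (mx4_inv23 mM phiK tM uM vM wM) mul1mx (mx4_invr phiK tM uM vM wM).
rewrite !mulmxA -(mulmxA M34) (mx4_inv12 mM psiK tM uM vM wM) mulmx1.
by rewrite (mx4_inv34 mM psiK tM uM vM wM) mul1mx.
Qed.

Let alpha (h : H) : K := antipode_alpha H h.
Let beta (h : H) : K := antipode_beta H h.

Let antipode_al (I : finType) (t : I -> I -> H) : comatrix t -> forall i l,
  \sum_j \sum_k alpha (t j k) *: (antip (t i j) \cm t k l) = alpha (t i l) *: cqone.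
Proof.
move=> tM i l; have [_ /(_ (t i l)) e _ _ _] := cqh_axioms H.
rewrite -[RHS]e sw3_comatrix // => x y; rewrite /cqmul; linear_tac.
Qed.

Let antipode_be (I : finType) (t : I -> I -> H) : comatrix t -> forall i l,
  \sum_j \sum_k beta (t j k) *: (t i j \cm antip (t k l)) = beta (t i l) *: cqone.
Proof.
move=> tM i l; have [_ _ /(_ (t i l)) e _ _] := cqh_axioms H.
rewrite -[RHS]e sw3_comatrix // => x y; rewrite /cqmul; linear_tac.
Qed.

Let antipode_psi (I : finType) (t : I -> I -> H) : comatrix t -> forall i n,
  \sum_j \sum_k \sum_l \sum_m
    psi (t i j) (antip (t k l)) (t m n) * beta (t j k) * alpha (t l m) = (i == n)%:R.
Proof.
move=> tM i n; have [_ _ _ /(_ (t i n)) e _] := cqh_axioms H.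
rewrite -(tM i n).2 -[RHS]e /sw5 /sw4 /sw3; apply/esym.
transitivity (\sum_m \sum_l \sum_k \sum_j
    psi (t i j) (antip (t k l)) (t m n) * beta (t j k) * alpha (t l m)).
  do 3!(sw2_step; apply: eq_bigr => ? _); sw2_step.
pull_sum 3%N; apply: eq_bigr => j _; pull_sum 2%N; apply: eq_bigr => k _.
by rewrite exchange_big.
Qed.

Let antipode_phi (I : finType) (t : I -> I -> H) : comatrix t -> forall i n,
  \sum_j \sum_k \sum_l \sum_m
    phi (antip (t i j)) (t k l) (antip (t m n)) * alpha (t j k) * beta (t l m) = (i == n)%:R.
Proof.
move=> tM i n; have [_ _ _ _ /(_ (t i n)) e] := cqh_axioms H.
rewrite -(tM i n).2 -[RHS]e /sw5 /sw4 /sw3; apply/esym.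
transitivity (\sum_m \sum_l \sum_k \sum_j
    phi (antip (t i j)) (t k l) (antip (t m n)) * alpha (t j k) * beta (t l m)).
  do 3!(sw2_step; apply: eq_bigr => ? _); sw2_step.
pull_sum 3%N; apply: eq_bigr => j _; pull_sum 2%N; apply: eq_bigr => k _.
by rewrite exchange_big.
Qed.

Let al_scalar : scalar alpha. Proof. exact: linearP. Qed.
Let be_scalar : scalar beta. Proof. exact: linearP. Qed.
Let one_mul (c : H) : cqone \cm c = c.
Proof. by have [_ _ e _ _] := cqb_axioms H; have [] := e c. Qed.
Let mul_one (c : H) : c \cm cqone = c.
Proof. by have [_ _ e _ _] := cqb_axioms H; have [] := e c. Qed.

Definition coquasi_hopf_data : hopf_data H :=
  HopfData mul1 mul2 phi1 phi2 phi3 psi1 psi2 psi3 S_linear Sbar_linear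
    al_scalar be_scalar mulM oneM SM SbarM SK SbarK one_mul mul_one phi_one
    psi_one phiK psiK quasi_assoc quasi_assocV pentagon pentagonV antipode_al
    antipode_be antipode_psi antipode_phi.

End HopfData.

(** * The formula for the fourth power of the antipode *)

Section Antipode.
Variables (K : fieldType) (C : coalgebra K) (D : hopf_data C).

Let SS (x : C) : C := antip D (antip D x).

Let SS_linear : linear SS.
Proof. exact: linear_comp (@S_lin _ _ D) (@S_lin _ _ D). Qed.

Lemma S2_scalar (n : {linear C -> K^o}) : scalar (fun x => n (antip D (antip D x)) : K).
Proof. exact: (scalar_comp (functional_scalar n) SS_linear). Qed.

Definition precompS2 n := functional (S2_scalar n).

(** S^2 is a coalgebra endomorphism, so actions of functionals pass through it; this brings the
    conjugation by the reassociator inside S^2. *)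
Lemma hit_left_S2 n x : n -\> antip D (antip D x) = antip D (antip D (precompS2 n -\> x)).
Proof.
move: x; apply: comatrix_ext.
- exact: (linear_comp (hit_left_linear n) SS_linear).
- exact: (linear_comp SS_linear (hit_left_linear _)).
move=> I t i j tM; have SM := S_comatrix D (S_comatrix D tM).
rewrite (hit_left_comatrix n i j SM) hit_left_comatrix //.
by rewrite [RHS](lin_comb _ _ SS_linear).
Qed.

Lemma hit_right_S2 n x : antip D (antip D x) <\- n = antip D (antip D (x <\- precompS2 n)).
Proof.
move: x; apply: comatrix_ext.
- exact: (linear_comp (hit_right_linear n) SS_linear).
- exact: (linear_comp SS_linear (hit_right_linear _)).
move=> I t i j tM; have SM := S_comatrix D (S_comatrix D tM).
rewrite (hit_right_comatrix n i j SM) hit_right_comatrix //.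
by rewrite [RHS](lin_comb _ _ SS_linear).
Qed.

Lemma conv_S2 n m x : conv (precompS2 n) (precompS2 m) x = conv n m (antip D (antip D x)).
Proof. by rewrite !conv_hit_left hit_left_S2. Qed.

Lemma counit_S2 x : counit C (antip D (antip D x)) = counit C x.
Proof.
move: x; apply: comatrix_extK; try exact: functional_scalar.
  exact: (S2_scalar (counit C)).
move=> I t i j tM; rewrite (tM _ _).2.
exact: (S_comatrix D (S_comatrix D tM) i j).2.
Qed.

End Antipode.

Theorem radford_S4 (K : fieldType) (C : coalgebra K) (D : hopf_data C) (a : C) :
  comatrix (fun _ _ : unit => a) ->
  (forall f : {linear C -> K^o},
    (forall x, f -\> x = (f x : K) *: one D) ->
    forall x, x <\- f = (f x : K) *: a) ->
  exists sigma sigmaV : {linear C -> K^o},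
    conv_inverse sigma sigmaV /\
    forall x, mul D (antip D a) (mul D (antipV D (antipV D x)) a) =
      antip D (antip D (sigma -\> x <\- sigmaV)).
Proof.
move=> aM fa; have [m [z0 fz0]] := exists_cointegral D.
set f := trace_form D m in fz0; have lf : scalar f := trace_form_scalar D m.
have fL (I : finType) (t : I -> I -> C) i j : comatrix t ->
    \sum_k f (t k j) *: t i k = f (t i j) *: one D.
  by move=> tM; apply: trace_form_cointegral.
have fR (I : finType) (t : I -> I -> C) i j : comatrix t ->
    \sum_k f (t i k) *: t k j = f (t i j) *: a.
  move=> tM; rewrite -(hit_right_comatrix (functional lf) i j tM) fa // => {j} x.
  move: x; apply: comatrix_ext => [||J u p q uM].
  - exact: hit_left_linear.
  - exact: linear_scale_scalar.
  - by rewrite hit_left_comatrix // [LHS]fL.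
have [L [Lsurj Linj LN]] := frobenius_generator aM lf fL fR (ex_intro _ z0 fz0).
(* The conditions on f and a mention only the coalgebra and the unit, which the opposite algebra
   shares, so the same f and a can be used. *)
have [L' [L'surj L'inj L'N]] :=
  @frobenius_generator _ _ (op_data D) _ _ aM lf fL fR (ex_intro _ z0 fz0).
have [c L'E] := Lsurj L'; have [d LE] := L'surj L.
have cd : conv_inverse c d.
  split; first by apply: (Linj (convf c d)); rewrite -hit_right_conv -L'E -LE hit_right_counit.
  by apply: (L'inj (convf d c)); rewrite -hit_right_conv -LE -L'E hit_right_counit.
have lT1 : linear (fun x => mul D a (antip D (antip D x))).
  exact: (linear_comp (mul_linr D a) (linear_comp (@S_lin _ _ D) (@S_lin _ _ D))).
have lT2 : linear (fun x => mul D (antipV D (antipV D x)) a).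
  exact: (linear_comp (mul_linl D a) (linear_comp (@Sb_lin _ _ D) (@Sb_lin _ _ D))).
(* For each functional n, computing n -\> L' through L gives L acted on by n1 followed by c, and
   computing it through L' gives c followed by n2; injectivity of the action on L identifies the two
   convolutions. *)
have T12 z : mul D a (antip D (antip D (c -\> z))) = mul D (antipV D (antipV D (z <\- c))) a.
  apply: eq_coord => n ln; pose nf := functional ln.
  pose n1 := functional (scalar_comp ln lT1); pose n2 := functional (scalar_comp ln lT2).
  rewrite -[LHS]/(n1 (c -\> z)) -[RHS]/(n2 (z <\- c)) -conv_hit_left -conv_hit_right.
  apply: (Linj (convf n1 c) (convf c n2)).
  rewrite -!hit_right_conv -(LN nf n1) // -hit_comm -L'E.
  by rewrite (L'N nf n2).
have [gA gB] := gphi_inverse D aM; have [cdE dcE] := cd.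
(* With x = (x <\- d) <\- c, [T12] produces a S^2(c -\> (x <\- d)), and cancelling a conjugates by
   [gphi]. Carried through S^2 it becomes v, so that sigma is v convolved with c. *)
pose v := precompS2 D (gphi D a); pose v' := precompS2 D (gpsi D a).
have vv' x : conv v v' x = counit C x by rewrite conv_S2 gA counit_S2.
have v'v x : conv v' v x = counit C x by rewrite conv_S2 gB counit_S2.
exists (convf v c), (convf d v'); split.
  split=> x /=; rewrite conv_hit_left -hit_left_conv /= conv_hit_left.
    by rewrite hit_leftK // -conv_hit_left vv'.
  by rewrite hit_leftK // -conv_hit_left dcE.
move=> x; rewrite -[X in antipV D (antipV D X)](hit_rightK x dcE) -T12 grouplike_mulK //.
rewrite hit_left_S2 hit_right_S2 -/v -/v'; congr (antip D (antip D _)).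
by rewrite hit_comm -[RHS]hit_right_conv -hit_left_conv hit_comm.
Qed.

Theorem theorem8 (K : fieldType) (H : coquasi_hopf K) (Sbar : H -> H) (a : H)
    (SK : cancel (antipode H) Sbar) (SbarK : cancel Sbar (antipode H))
    (ha : modular_element a) :
  exists sigma sigmaV : {linear H -> K^o},
    conv_inverse sigma sigmaV /\
    forall x : H,
      grouplike_inv a \cm (Sbar (Sbar x) \cm a) =
      antipode H (antipode H (sigma -\> x <\- sigmaV)).
Proof.
have [[aM ae] af] := ha.
apply: (@radford_S4 K H (coquasi_hopf_data SK SbarK) a) => [|f fL x].
  by move=> [] []; split; [rewrite sum_unit | rewrite ae].
exact: af.
Qed.
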